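(* Let $r>1$ be an integer. Then for any $k\in\mathbb{N}$ and all $f\in\mathcal{H}_{r,\mathrm{per}}$ we have $$|\hat f(k)|\le\int_0^1|f^{(r)}(x)|\,dx\;\frac{2\,b^{-\mu_{r,\mathrm{per}}(k)}}{(2\sin\frac\pi b)^r}\left(1+\frac1b+\frac1{b(b+1)}\right)^{r-2}\left(\frac72+\frac2b+\frac{2b+1}{b-1}\right).$$
   Context: Let $b\ge 2$ be an integer and $\omega_b=e^{2\pi \mathrm{i}/b}$; $\mathbb{N}=\{1,2,\ldots\}$. Each $k\in\mathbb{N}$ has the base $b$ expansion $k=\kappa_1b^{a_1-1}+\cdots+\kappa_vb^{a_v-1}$ with $v\ge1$, $0<\kappa_1,\ldots,\kappa_v<b$ and $a_1>\cdots>a_v>0$ integers; for $k=0$ set $v=0$. For $x\in[0,1)$ with base $b$ representation $x=\frac{x_1}{b}+\frac{x_2}{b^2}+\cdots$, $0\le x_i<b$, infinitely many $x_i\neq b-1$, the $k$th Walsh function is $\mathrm{wal}_k(x)=\omega_b^{\kappa_1x_{a_1}+\cdots+\kappa_vx_{a_v}}$, and $\mathrm{wal}_0(x)=1$. The $k$th Walsh coefficient of $f:[0,1]\to\mathbb{R}$ is $\hat f(k)=\int_0^1f(x)\overline{\mathrm{wal}_k(x)}\,dx$. For integers $r\ge0$, $k\ge0$ define $\mu_{r,\mathrm{per}}(k)=0$ if $r=0$ or $k=0$; $\mu_{r,\mathrm{per}}(k)=a_1+\cdots+a_v+(r-v)a_v$ if $1\le v<r$; and $\mu_{r,\mathrm{per}}(k)=a_1+\cdots+a_r$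 if $v\ge r\ge1$. For an integer $r>1$, $\mathcal{H}_r$ is the Sobolev space of real-valued functions $f:[0,1]\to\mathbb{R}$ (with $f,f',\ldots,f^{(r-1)}$ absolutely continuous and $f^{(r)}\in L_2([0,1])$) with inner product $$\langle f,g\rangle_r=\sum_{s=0}^{r-1}\int_0^1f^{(s)}(x)\,dx\int_0^1g^{(s)}(x)\,dx+\int_0^1f^{(r)}(x)g^{(r)}(x)\,dx,$$ where $f^{(s)}$ is the $s$th derivative of $f$ and $f^{(0)}=f$. $\mathcal{H}_{r,\mathrm{per}}$ is the space of all $f\in\mathcal{H}_r$ which satisfy $\int_0^1f^{(s)}(x)\,dx=0$ for $0\le s<r$. *)

(* Defs.v *)
From HB Require Import structures.
From mathcomp Require Import all_boot all_order all_algebra.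
From mathcomp Require Import all_classical all_reals all_analysis.
From mathcomp Require Import complex.

Set Implicit Arguments.
Unset Strict Implicit.
Unset Printing Implicit Defensive.

Import Order.TTheory GRing.Theory Num.Theory.
Import numFieldNormedType.Exports.
Import ComplexField.Normc.

Local Open Scope classical_set_scope.
Local Open Scope ring_scope.

(* The coefficient of b^(a - 1) in the base b expansion of k; the positions a
   start at 1. *)
Definition ndigit (b k a : nat) : nat := ((k %/ b ^ a.-1) %% b)%N.

(* The positions a_1 > ... > a_v in the expansion
   k = kappa_1 b^(a_1 - 1) + ... + kappa_v b^(a_v - 1), see [positionsP].
   They are bounded by k because k < b^k when 1 < b. *)
Definition positions (b k : nat) : seq nat :=
  [seq a <- rev (iota 1 k) | (0 < ndigit b k a)%N].

Lemma positionsP (b k : nat) : (1 < b)%N ->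
  [/\ sorted gtn (positions b k),
      {in positions b k, forall a, (0 < a)%N /\ (0 < ndigit b k a < b)%N} &
      k = (\sum_(a <- positions b k) ndigit b k a * b ^ a.-1)%N].
Proof.
move=> b1; split.
- apply: sorted_filter; first exact/rev_trans/ltn_trans.
  by rewrite rev_sorted iota_ltn_sorted.
- move=> a; rewrite mem_filter mem_rev mem_iota => /andP[d0 /andP[a0 _]].
  by split=> //; rewrite d0 ltn_pmod// ltnW.
- rewrite big_filter big_mkcond/= (eq_bigr (fun a => ndigit b k a * b ^ a.-1)%N);
    last by move=> a _; case: ltnP => //; rewrite leqn0 => /eqP ->.
  have -> : (\sum_(a <- rev (iota 1 k)) ndigit b k a * b ^ a.-1 =
    \sum_(a <- iota 1 k) ndigit b k a * b ^ a.-1)%N.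
    by apply: perm_big; rewrite perm_rev.
  rewrite (iotaDl 1 0).
  rewrite big_map.
  have partial m : (\sum_(i <- iota 0 m) ndigit b k (1 + i) * b ^ (1 + i).-1
      = k %% b ^ m)%N.
    elim: m => [|m IHm]; first by rewrite big_nil expn0 modn1.
    rewrite -addn1 iotaD big_cat IHm big_seq1 /ndigit add0n add1n /= addn1.
    rewrite [in RHS](divn_eq k (b ^ m)) expnSr.
    set q := (k %/ b ^ m)%N; set t := (k %% b ^ m)%N.
    have tb : (t < b ^ m)%N by rewrite ltn_pmod// expn_gt0 (ltnW b1).
    have qb : (q %% b < b)%N by rewrite ltn_pmod// ltnW.
    have rb : (q %% b * b ^ m + t < b ^ m * b)%N.
      apply: (@leq_trans ((q %% b).+1 * b ^ m)).
        by rewrite mulSn addnC ltn_add2r.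
      by rewrite mulnC leq_mul2l qb orbT.
    rewrite {2}(divn_eq q b) mulnDl -mulnA [(b * _)%N]mulnC -addnA modnMDl.
    by rewrite [RHS]modn_small// addnC.
  rewrite partial modn_small//; exact: ltn_expl.
Qed.

Definition mu_per (b r k : nat) : nat :=
  let a := positions b k in let v := size a in
  if (r == 0)%N || (k == 0)%N then 0%N
  else if (v < r)%N then (sumn a + (r - v) * last 0 a)%N
  else sumn (take r a).

Section Walsh.
Variable R : realType.

(* The digit x_i of x = x_1 / b + x_2 / b^2 + ..., for the representation with
   infinitely many digits different from b - 1, see [rdigitP]. *)
Definition rdigit (b : nat) (x : R) (i : nat) : nat :=
  (Num.truncn (b%:R ^+ i * x) %% b)%N.

Lemma rdigitP (b : nat) (x : R) : (1 < b)%N -> 0 <= x < 1 ->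
  [/\ forall i, (rdigit b x i < b)%N,
      \sum_(1 <= i < n) (rdigit b x i)%:R / b%:R ^+ i @[n --> \oo] --> x &
      forall N, exists2 i, (N <= i)%N & rdigit b x i != b.-1].
Proof.
move=> b1 /andP[x0 x1].
have b0 : (0 < b)%N := ltnW b1.
have bR0 : 0 < b%:R :> R by rewrite ltr0n.
have bn0 n : 0 < b%:R ^+ n :> R by rewrite exprn_gt0.
pose t n := Num.truncn (b%:R ^+ n * x).
have tP n : (t n)%:R <= b%:R ^+ n * x < (t n).+1%:R.
  by rewrite truncn_itv// mulr_ge0// ltW.
have tS n : t n.+1 = (t n * b + rdigit b x n.+1)%N.
  rewrite /rdigit -/(t _) {1}(divn_eq (t n.+1) b); congr (_ * _ + _)%N.
  apply/esym/truncn_def; have /andP[lo hi] := tP n.+1.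
  move: lo hi; rewrite exprS -mulrA => lo hi; apply/andP; split.
    rewrite -(ler_pM2l bR0); apply: le_trans lo.
    by rewrite -natrM ler_nat mulnC leq_divM.
  rewrite -(ltr_pM2l bR0); apply: lt_le_trans hi _.
  by rewrite -natrM ler_nat mulnC ltn_ceil.
have t0 : t 0 = 0%N by apply: truncn_def; rewrite expr0 mul1r x0.
split.
- by move=> i; rewrite ltn_pmod.
- have sumE n : \sum_(1 <= i < n.+1) (rdigit b x i)%:R / b%:R ^+ i
      = (t n)%:R / b%:R ^+ n :> R.
    elim: n => [|n IHn]; first by rewrite big_nil t0 mul0r.
    rewrite big_nat_recr//= IHn tS natrD natrM mulrDl; congr (_ + _).
    by rewrite exprS invfM mulrA mulfK// lt0r_neq0.
  rewrite -cvg_shiftS /=.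
  under eq_fun do rewrite sumE.
  have h0 : (b%:R^-1 : R) ^+ n @[n --> \oo] --> (0 : R).
    by apply: cvg_expr; rewrite ger0_norm ?invr_ge0 ?ltW// invf_lt1// ltr1n.
  apply: (@squeeze_cvgr _ _ _ _ (fun n => x - b%:R^-1 ^+ n) (cst x)).
  + apply: nearW => n; have /andP[lo hi] := tP n; apply/andP; split.
      rewrite lerBlDr exprVn -[X in _ + X]mul1r -mulrDl ler_pdivlMr// mulrC.
      by rewrite -natr1 in hi; exact: ltW.
    by rewrite ler_pdivrMr// mulrC.
  + by rewrite -[X in _ --> X]subr0; apply: cvgB => //; exact: cvg_cst.
  + exact: cvg_cst.
- move=> N; apply: contrapT => noi.
  have dE i : (N <= i)%N -> rdigit b x i = b.-1.
    by move=> Ni; apply/eqP/negPn/negP => di; apply: noi; exists i.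
  have tE m : (t (N + m)%N).+1 = ((t N).+1 * b ^ m)%N.
    elim: m => [|m IHm]; first by rewrite addn0 expn0 muln1.
    rewrite addnS tS dE ?leqW ?leq_addr// expnSr mulnA -IHm mulSn.
    by rewrite -addnS prednK// addnC.
  have /andP[_ hi] := tP N.
  set d := (t N).+1%:R - b%:R ^+ N * x.
  have d0 : 0 < d by rewrite subr_gt0.
  have dle m : b%:R ^+ m * d <= 1.
    have /andP[lo _] := tP (N + m)%N.
    rewrite /d mulrBr mulrA -exprD addnC [X in X - _]mulrC -natrX -natrM -tE.
    by rewrite -natr1 addrAC -lerBrDr subrr subr_le0.
  pose m := (Num.truncn d^-1).+1.
  have : d^-1 < b%:R ^+ m.
    apply: lt_trans (_ : m%:R < _); first by rewrite truncnS_gt.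
    by rewrite -natrX ltr_nat ltn_expl.
  rewrite -(ltr_pM2r d0) mulVf ?lt0r_neq0// => /lt_le_trans /(_ (dle m)).
  by rewrite ltxx.
Qed.

Definition omega (b : nat) : R[i] :=
  Complex (cos (2 * pi / b%:R)) (sin (2 * pi / b%:R)).

Definition wal (b k : nat) (x : R) : R[i] :=
  omega b ^+ (\sum_(a <- positions b k) ndigit b k a * rdigit b x a)%N.

Definition cintegral (A : set R) (g : R -> R[i]) : R[i] :=
  Complex (\int[lebesgue_measure]_(x in A) complex.Re (g x))
          (\int[lebesgue_measure]_(x in A) complex.Im (g x)).

Definition walsh_coeff (b : nat) (f : R -> R) (k : nat) : R[i] :=
  cintegral `[0, 1] (fun x => (f x)%:C%C * conjc (wal b k x)).

End Walsh.

(* A function [0, 1] -> R is represented by f : R -> R; nothing below depends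
   on the values of f outside [0, 1]. *)
Section Sobolev.
Variable R : realType.

(* Derivative of a function defined on A only: at an end point of an interval A
   it is one-sided, unlike [derive1]. *)
Definition derivable_in (A : set R) (f : R -> R) (x : R) : Prop :=
  cvg ((f y - f x) / (y - x) @[y --> within A x^']).

Definition derive_in (A : set R) (f : R -> R) (x : R) : R :=
  lim ((f y - f x) / (y - x) @[y --> within A x^']).

Lemma derive_inE (A : set R) (f : R -> R) (x : R) :
  (A°) x -> derive_in A f x = derive1 f x.
Proof.
move=> Ax; rewrite /derive_in /derive1; congr (lim _).
apply/seteqP; split => B /=; rewrite /nbhs/= /within/= /dnbhs/= /within/=.
- move=> /nbhs_ballP[e/= e0 xB]; have /nbhs_ballP[d/= d0 xA] := Ax.
  apply/nbhs_ballP; exists (Num.min d e) => /=; first by rewrite lt_min d0.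
  move=> h; rewrite /ball/= sub0r normrN lt_min => /andP[hd he] h0.
  have /= := xB (h + x); rewrite /ball/= opprD addrCA subrr addr0 normrN.
  rewrite -subr_eq0 addrK [_ *: _]mulrC; apply => //; apply: xA.
  by rewrite /ball/= opprD addrCA subrr addr0 normrN.
- move=> /nbhs_ballP[e/= e0 xB]; apply/nbhs_ballP; exists e => //= y.
  rewrite /ball/= => yx yNx _; have := xB (y - x).
  rewrite /ball/= sub0r normrN distrC subrK subr_eq0 mulrC; exact.
Qed.

Definition derive_in_n (A : set R) (s : nat) (f : R -> R) : R -> R :=
  iter s (derive_in A) f.

Definition abs_continuous (u v : R) (f : R -> R) : Prop :=
  forall e : R, 0 < e -> exists2 d : R, 0 < d &
    forall (n : nat) (a c : 'I_n -> R),
      (forall i, [/\ u <= a i, a i <= c i & c i <= v]) ->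
      trivIset [set: 'I_n] (fun i => `]a i, c i[%classic) ->
      \sum_(i < n) (c i - a i) < d ->
      \sum_(i < n) `|f (c i) - f (a i)| < e.

(* f^(r) exists almost everywhere, as f^(r-1) is absolutely continuous;
   [derive_in] is a fixed constant where the limit does not exist. *)
Definition sobolev (r : nat) (f : R -> R) : Prop :=
  [/\ forall s, (s < r)%N -> abs_continuous 0 1 (derive_in_n `[0, 1] s f),
      forall s x, (s.+1 < r)%N -> 0 <= x <= 1 ->
        derivable_in `[0, 1] (derive_in_n `[0, 1] s f) x &
      (derive_in_n `[0, 1] r f) \_ `[0, 1] \in
        Lfun (@lebesgue_measure R) 2%:E].

Definition sobolev_per (r : nat) (f : R -> R) : Prop :=
  sobolev r f /\
  forall s, (s < r)%N ->
    \int[lebesgue_measure]_(x in `[0, 1]) derive_in_n `[0, 1] s f x = 0.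

End Sobolev.

(* Main.v *)
From HB Require Import structures.
Require Import Defs.
From mathcomp Require Import all_boot all_order all_algebra.
From mathcomp Require Import all_classical all_reals all_analysis.
From mathcomp Require Import complex.
From mathcomp Require Import measurable_realfun finmap ring lra zify.

Set Implicit Arguments.
Unset Strict Implicit.
Unset Printing Implicit Defensive.

Import Order.TTheory GRing.Theory Num.Theory.
Import numFieldNormedType.Exports.
Import ComplexField.Normc.
Local Open Scope classical_set_scope.
Local Open Scope ring_scope.

(* Let W_k denote the conjugate Walsh function, f^(s)^ the Walsh coefficients of
   f^(s), and let k = kappa b^(a-1) + k' with k' < b^(a-1).  Up to the factor
   b^-a, the primitive of W_k is a combination of W_k', W_k and of the W_m with
   m = t b^(a+c-1) + k, 0 < t < b, c >= 1, with coefficients bounded in modulus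
   by S = 1 / (2 sin (pi/b)), S and S b^-c respectively.  Integration by parts
   thus bounds f^(s)^(k) in terms of f^(s+1)^(k'), f^(s+1)^(k) and
   f^(s+1)^(m).  The coefficients of f^(r) are bounded by its L1 norm; each
   of the remaining steps costs S (1 + 1/b + 1/(b(b+1))) and turns
   b^-mu_(j,per) into b^-mu_(j+1,per), the term f^(s+1)^(0) being zero by
   periodicity.  The primitive is handled through Abel summation on the grid of
   mesh b^-n, letting n tend to infinity at each step, so that no infinite Walsh
   series is ever needed.  An absolutely continuous function is the integral of
   its derivative by the Radon-Nikodym theorem, applied to the Stieltjes measures
   of its Jordan decomposition, and Lebesgue's differentiation theorem. *)

(** * Absolutely continuous functions are integrals of their derivatives *)

Section AbsoluteContinuity.
Variable R : realType.
Implicit Types (g F : R -> R) (L : seq (R * R)).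
Local Notation mu := (@lebesgue_measure R).

Definition nonoverlapping (p q : R * R) := (p.2 <= q.1) || (q.2 <= p.1).
Definition in_unit_itv (p : R * R) := [&& 0 <= p.1, p.1 <= p.2 & p.2 <= 1].

(** Lists, unlike families indexed by ['I_n], can be concatenated and refined, as the passage to
    total variations requires. *)
Lemma ac_seq g : abs_continuous 0 1 g -> forall e, 0 < e ->
  exists2 d, 0 < d & forall L, all in_unit_itv L -> pairwise nonoverlapping L ->
    \sum_(p <- L) (p.2 - p.1) < d -> \sum_(p <- L) `|g p.2 - g p.1| < e.
Proof.
move=> gac e /gac[d d0 dP]; exists d => // L L01 Lsep Ld.
pose z : R * R := (0, 0).
pose a (i : 'I_(size L)) := (nth z L i).1.
pose c (i : 'I_(size L)) := (nth z L i).2.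
have := dP _ a c; rewrite (big_nth z) big_mkord in Ld.
rewrite (big_nth z) big_mkord; apply => //.
- by move=> i; have /and3P[] := allP L01 _ (mem_nth z (ltn_ord i)).
- have key (i j : 'I_(size L)) : (i < j)%N ->
      `]a i, c i[%classic `&` `]a j, c j[%classic !=set0 -> False.
    move=> ij [x [/=]]; rewrite !in_itv/= => /andP[h1 h2] /andP[h3 h4].
    have /orP[] := pairwiseP z Lsep i j (ltn_ord i) (ltn_ord j) ij.
      rewrite -/(c i) -/(a j) => ca; have := lt_trans (lt_le_trans h2 ca) h3.
      by rewrite ltxx.
    rewrite -/(c j) -/(a i) => ca; have := lt_trans (lt_le_trans h4 ca) h1.
    by rewrite ltxx.
  move=> i j _ _ ij; apply/val_inj; have [/key|/key|//] := ltngtP i j.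
    by case.
  by rewrite setIC; case.
Qed.

Lemma variation_zipE (a b : R) g s : itv_partition a b s -> variation a b g s =
  \sum_(p <- zip (a :: s) s) `|g p.2 - g p.1|.
Proof.
move=> /variation_zip ->; elim: s a => [|x s IHs] a /=; first by rewrite !big_nil.
by rewrite !big_cons IHs.
Qed.

Lemma zip_sum_length (a : R) s :
  \sum_(p <- zip (a :: s) s) (p.2 - p.1) = last a s - a.
Proof.
elim: s a => [|x s IHs] a /=; first by rewrite big_nil subrr.
by rewrite big_cons /= IHs addrC addrA subrK.
Qed.

Lemma zip_path_bounds (a : R) s : path <%R a s ->
  all (fun p => [&& a <= p.1, p.1 <= p.2 & p.2 <= last a s]) (zip (a :: s) s).
Proof.
elim: s a => [//|x s IHs] a /= /andP[ax xs]; rewrite lexx (ltW ax) /=.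
have -> /= : x <= last x s.
  elim: s x xs {IHs ax} => /= [x _|y s IH x /andP[xy ys]]; first exact: lexx.
  by rewrite (le_trans (ltW xy)) ?IH.
apply: sub_all (IHs _ xs) => p /and3P[xp -> ->].
by rewrite (le_trans (ltW ax) xp).
Qed.

Lemma zip_path_nonoverlapping (a : R) s : path <%R a s ->
  pairwise nonoverlapping (zip (a :: s) s).
Proof.
elim: s a => [//|x s IHs] a /= /andP[ax xs]; rewrite IHs// andbT.
apply: sub_all (zip_path_bounds xs) => p /and3P[xp _ _].
by rewrite /nonoverlapping/= xp.
Qed.

(** Replacing each interval by a partition of it keeps the total length, so the bound of absolute
    continuity survives the suprema over partitions; only strictness is lost. *)
Lemma ac_total_variation g : abs_continuous 0 1 g -> forall e, 0 < e ->
  exists2 d, 0 < d & forall L, all in_unit_itv L -> pairwise nonoverlapping L ->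
    \sum_(p <- L) (p.2 - p.1) < d ->
    (\sum_(p <- L) total_variation p.1 p.2 g <= e%:E)%E.
Proof.
move=> gac e /(ac_seq gac)[d d0 dP]; exists d => //.
(* The intervals of L2 are moved one by one to L1, each being refined by the
   points of a partition that realizes a given variation. *)
have key L2 L1 : all in_unit_itv (L1 ++ L2) -> pairwise nonoverlapping (L1 ++ L2) ->
    \sum_(p <- L1 ++ L2) (p.2 - p.1) < d ->
    ((\sum_(p <- L1) `|g p.2 - g p.1|)%:E +
      \sum_(p <- L2) total_variation p.1 p.2 g <= e%:E)%E.
  elim: L2 L1 => [|[a c] L IH] L1.
    rewrite cats0 big_nil adde0 lee_fin => h1 h2 h3; exact/ltW/dP.
  rewrite all_cat /= => /and3P[L101 ac01 L01].
  rewrite pairwise_cat pairwise_cons allrel_consr.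
  move=> /and3P[/andP[L1ac L1L] L1s /andP[acL Ls]].
  have /and3P[/= a0 ac c1] := ac01.
  rewrite big_cat big_cons /= => h3.
  (* The sum is finite by the induction hypothesis for an empty [L1], so [S] can be moved to the
     other side. *)
  have [S SE] : exists S : R,
      (\sum_(p <- L) total_variation p.1 p.2 g)%E = S%:E.
    suff /fineK <- : (\sum_(p <- L) total_variation p.1 p.2 g)%E \is a fin_num.
      by eexists.
    rewrite ge0_fin_numE; last first.
      rewrite big_seq; apply: sume_ge0 => p pL; apply: total_variation_ge0.
      by have /and3P[] := allP L01 _ pL.
    apply: (@le_lt_trans _ _ e%:E); last exact: ltry.
    have := IH [::]; rewrite big_nil add0e; apply => //.
    apply: le_lt_trans h3; rewrite /= addrA lerDr.
    rewrite addr_ge0 ?subr_ge0// big_seq sumr_ge0// => p pL1.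
    by rewrite subr_ge0; have /and3P[] := allP L101 _ pL1.
  rewrite big_cons SE /= addeCA -EFinD -leeBrDr// -EFinB.
  apply: ge_ereal_sup => _ [_ [s sac <-] <-].
  rewrite lee_fin lerBrDr variation_zipE// addrCA addrA.
  have [sp /eqP slast] := sac.
  have bs := zip_path_bounds sp; rewrite slast in bs.
  have := IH (L1 ++ zip (a :: s) s); rewrite SE -EFinD lee_fin.
  rewrite !big_cat/= !all_cat L101 L01 andbT /=; apply.
  - apply: sub_all bs => p /and3P[ap p12 pc]; apply/and3P; split => //.
      exact: le_trans ap.
    exact: le_trans c1.
  - rewrite !pairwise_cat L1s Ls (zip_path_nonoverlapping sp) !andbT.
    have sepl (q p : R * R) : [&& a <= p.1, p.1 <= p.2 & p.2 <= c] ->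
        nonoverlapping q (a, c) -> nonoverlapping q p.
      move=> /and3P[ap _ pc] /orP[/= h|/= h]; apply/orP; [left|right].
        exact: le_trans ap.
      exact: le_trans h.
    have sepC (q p : R * R) : nonoverlapping q p = nonoverlapping p q.
      by rewrite /nonoverlapping orbC.
    apply/andP; split.
      rewrite allrel_catl L1L /=; apply/allrelP => p q pz qL.
      rewrite sepC; apply: sepl; first exact: (allP bs).
      by rewrite sepC; exact: (allP acL).
    apply/allrelP => p q pL1 qz; apply: sepl; first exact: (allP bs).
    exact: (allP L1ac).
  - by rewrite zip_sum_length slast -addrA.
by move=> L h1 h2 h3; have := key L [::]; rewrite big_nil add0e; exact.
Qed.

Definition monotone_ac F := forall e, 0 < e ->
  exists2 d, 0 < d & forall L, all in_unit_itv L -> pairwise nonoverlapping L ->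
    \sum_(p <- L) (p.2 - p.1) < d -> \sum_(p <- L) (F p.2 - F p.1) <= e.

(** [0, 1] is cut into [N] equal pieces shorter than the [d] that belongs to e = 1; each piece has
    variation at most 1. *)
Lemma ac_total_variation_fin g x y : abs_continuous 0 1 g ->
  0 <= x -> x <= y -> y <= 1 -> total_variation x y g \is a fin_num.
Proof.
move=> gac x0 xy y1; have [d d0 dP] := ac_total_variation gac (@ltr01 R).
pose N := (Num.truncn d^-1).+1.
have Nd : N%:R^-1 < d.
  by rewrite invf_plt ?posrE// ?ltr0n// truncnS_gt.
have N0 : 0 < N%:R :> R by rewrite ltr0n.
have tvi i : (i <= N)%N -> (total_variation 0 (i%:R / N%:R) g <= i%:R%:E)%E.
  elim: i => [_|i IH iN]; first by rewrite mul0r total_variationxx.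
  have i0 : 0 <= i%:R / N%:R :> R by rewrite divr_ge0.
  have ii : i%:R / N%:R <= i.+1%:R / N%:R :> R.
    by rewrite ler_pM2r ?invr_gt0// ler_nat.
  have iS : i.+1%:R / N%:R <= 1 :> R by rewrite ler_pdivrMr// mul1r ler_nat.
  rewrite (total_variationD _ i0 ii) -[X in (_ <= X%:E)%E]natr1 EFinD.
  apply: leeD; first exact/IH/ltnW.
  have : i.+1%:R / N%:R - i%:R / N%:R < d.
    by rewrite -mulrBl -natrB// subSnn mul1r.
  move: i0 ii iS; set u := i%:R / N%:R; set v := i.+1%:R / N%:R => u0 uv v1 vud.
  have := dP [:: (u, v)]; rewrite !big_seq1; apply => //.
  by rewrite all_seq1 /in_unit_itv/= u0 uv v1.
have tv1 : (total_variation 0 1 g <= N%:R%:E)%E.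
  by have := tvi N (leqnn N); rewrite divff// gt_eqF.
rewrite ge0_fin_numE ?total_variation_ge0//.
apply: le_lt_trans (ltry N%:R); apply: le_trans tv1.
rewrite (@total_variationD _ 0 1 x)// ?(le_trans xy)//.
rewrite (@total_variationD _ x 1 y)//.
apply: (@le_trans _ _ (total_variation x y g + total_variation y 1 g)%E).
  by rewrite leeDl// total_variation_ge0.
by rewrite leeDr// total_variation_ge0.
Qed.

(* The Jordan decomposition g = F - (F - g), with F the total variation of g. *)
Lemma ac_sub_monotone g : abs_continuous 0 1 g -> exists F : R -> R,
  [/\ monotone_ac F, monotone_ac (fun x => F x - g x) &
    forall x y, 0 <= x -> x <= y -> y <= 1 -> `|g y - g x| <= F y - F x].
Proof.
move=> gac; pose F x := fine (total_variation 0 x g); exists F.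
have FE x y : 0 <= x -> x <= y -> y <= 1 ->
    (F y - F x)%:E = total_variation x y g.
  move=> x0 xy y1; have x1 := le_trans xy y1; have y0 := le_trans x0 xy.
  rewrite EFinB /F !fineK ?ac_total_variation_fin//.
  by rewrite (total_variationD _ x0 xy) addeAC subee ?add0e ?ac_total_variation_fin.
have Fac : monotone_ac F.
  move=> e /(ac_total_variation gac)[d d0 dP]; exists d => // L L01 Ls Ld.
  rewrite -lee_fin -sumEFin; apply: le_trans (dP L L01 Ls Ld).
  rewrite big_seq [leRHS]big_seq; apply: lee_sum => p /(allP L01)/and3P[p0 p12 p1].
  by rewrite FE.
split => //.
- move=> e e0; have e2 : 0 < e / 2 by rewrite divr_gt0.
  have [d1 d10 P1] := Fac _ e2; have [d2 d20 P2] := ac_seq gac e2.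
  exists (Num.min d1 d2); first by rewrite lt_min d10.
  move=> L L01 Ls; rewrite lt_min => /andP[L1 L2].
  have h1 := P1 L L01 Ls L1; have h2 := P2 L L01 Ls L2.
  rewrite (eq_bigr (fun p => (F p.2 - F p.1) - (g p.2 - g p.1))); last first.
    by move=> p _; ring.
  rewrite big_split /= [leRHS]splitr lerD// sumrN.
  apply: le_trans (ler_norm _) _; rewrite normrN.
  exact: le_trans (ler_norm_sum _ _ _) (ltW h2).
- by move=> x y x0 xy y1; rewrite -lee_fin FE// total_variation_ge.
Qed.

Lemma lebesgue_stieltjes_itvoc (f : cumulative R R) (a c : R) : a <= c ->
  lebesgue_stieltjes_measure f `]a, c]%classic = (f c - f a)%:E.
Proof.
move=> ac; rewrite /lebesgue_stieltjes_measure /measure_extension.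
by rewrite measurable_mu_extE/= ?wlength_itv_bnd//; exact: is_ocitv.
Qed.

(** One list has to serve every cumulative function at once, because [stieltjes_dominates] compares
    the Stieltjes measure and the length of the same union. *)
Lemma ocitv_bigsetU_seq n (F : nat -> set (ocitv_type R)) :
  (forall i, measurable (F i)) -> exists L, [/\ pairwise nonoverlapping L,
    all (fun p => p.1 < p.2) L & forall f : cumulative R R,
    lebesgue_stieltjes_measure f (\big[setU/set0]_(k < n) F k) =
    (\sum_(p <- L) (f p.2 - f p.1)%:E)%E].
Proof.
move=> mF; set U : set (SetRing.type (ocitv_type R)) := \big[setU/set0]_(k < n) F k.
have [->|/set0P U0] := eqVneq U set0.
  by exists [::]; split => // f; rewrite big_nil measure0.
have mU : measurable U.
  by apply: bigsetU_measurable => i _; apply: SetRing.measurable_subring.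
pose B := SetRing.decomp U.
have Bfin : finite_set B := SetRing.decomp_finite_set U.
have BP X : B X -> exists p : R * R, p.1 < p.2 /\ X = `]p.1, p.2]%classic.
  move=> BX; have := SetRing.decomp_measurable mU (mem_set BX).
  move=> /ocitvP[X0|[p pl ->]]; last by exists p.
  by have /set0P := SetRing.all_decomp_neq0 U0 BX; rewrite X0 eqxx.
have [h hP] : exists h : set R -> R * R, forall X, B X ->
    (h X).1 < (h X).2 /\ X = `](h X).1, (h X).2]%classic.
  have /choice[h hP] : forall X, exists p : R * R, B X ->
      p.1 < p.2 /\ X = `]p.1, p.2]%classic.
    move=> X; have [BX|nBX] := pselect (B X); last by exists (0, 0).
    by have [p] := BP X BX; exists p.
  by exists h.
have inB X t : B X -> (h X).1 < t <= (h X).2 -> X t.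
  by move=> /hP[_ XE] tX; rewrite XE /= in_itv.
have memB X : X \in fset_set B -> B X.
  by move=> XB; apply: set_mem; rewrite -in_fset_set.
exists [seq h X | X <- fset_set B]; split.
- rewrite pairwise_map; have := fset_uniq (fset_set B).
  rewrite uniq_pairwise; apply: (@sub_in_pairwise _ (mem (fset_set B))); last first.
    by apply/allP.
  move=> X Y /memB BX /memB BY /= XY.
  have [X12 XE] := hP X BX; have [Y12 YE] := hP Y BY.
  rewrite /nonoverlapping; have [//|XY1] := leP (h X).2 (h Y).1.
  have [//|XY2] := leP (h Y).2 (h X).1.
  suff : X = Y by move=> XY'; rewrite XY' eqxx in XY.
  (* If two pieces overlap, the smaller of their right ends lies in both, and the pieces of a
     decomposition that meet are equal. *)
  apply: (SetRing.decomp_triv BX BY); exists (Num.min (h X).2 (h Y).2).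
  split; apply: inB => //.
    by rewrite lt_min X12 XY2 ge_min lexx.
  by rewrite lt_min XY1 Y12 ge_min lexx orbT.
- by apply/allP => _ /mapP[X /memB /hP[? _] ->].
- move=> f; rewrite big_map -(SetRing.cover_decomp U).
  rewrite measure_fin_bigcup//.
  + rewrite fsbig_finite//= big_seq [RHS]big_seq.
    apply: eq_bigr => X /memB /hP[X12 XE].
    by rewrite {1}XE lebesgue_stieltjes_itvoc// ltW.
  + exact: SetRing.decomp_triv.
  + by move=> X /hP[_ ->]; exact: measurable_itv.
Qed.

(** Composition with it extends a function on [0, 1] to the whole line by its end values, as a
    cumulative function requires. *)
Definition clamp01 (x : R) := Num.max 0 (Num.min x 1).

Lemma clamp01_ge0 x : 0 <= clamp01 x. Proof. by rewrite le_max lexx. Qed.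

Lemma clamp01_le1 x : clamp01 x <= 1.
Proof. by rewrite ge_max ler01 ge_min lexx orbT. Qed.

Lemma clamp01_id x : 0 <= x -> x <= 1 -> clamp01 x = x.
Proof. by move=> x0 x1; rewrite /clamp01 (min_idPl x1) (max_idPr x0). Qed.

Lemma clamp01_le x y : x <= y -> clamp01 x <= clamp01 y.
Proof.
by move=> xy; rewrite /clamp01; apply: le_max2 => //; apply: le_min2.
Qed.

Lemma clamp01_contract x y : x <= y -> clamp01 y - clamp01 x <= y - x.
Proof.
move=> xy; rewrite /clamp01 /Num.max /Num.min.
by do !case: ifPn; rewrite -?leNgt => *; lra.
Qed.

(** * Density of a monotone absolutely continuous function *)

Section Density.
Variable F : R -> R.
Hypothesis Fnd : forall x y, 0 <= x -> x <= y -> y <= 1 -> F x <= F y.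
Hypothesis Fac : monotone_ac F.

Lemma clamp01_nondecreasing : nondecreasing (F \o clamp01).
Proof.
by move=> x y xy /=; rewrite Fnd ?clamp01_ge0 ?clamp01_le1 ?clamp01_le.
Qed.

Lemma clamp01_right_continuous : right_continuous (F \o clamp01).
Proof.
move=> x; apply/cvgrPdist_lt => e e0; have e2 : 0 < e / 2 by rewrite divr_gt0.
have [d d0 dP] := Fac e2; near=> y.
have xy : x <= y by near: y; exact: nbhs_right_ge.
have yd : y < x + d by near: y; apply: nbhs_right_lt; rewrite ltrDl.
rewrite distrC ger0_norm ?subr_ge0 ?clamp01_nondecreasing//.
apply: (@le_lt_trans _ _ (e / 2)); last by rewrite ltr_pdivrMr// ltr_pMr// ltr1n.
have := dP [:: (clamp01 x, clamp01 y)]; rewrite !big_seq1; apply => //.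
  by rewrite all_seq1 /in_unit_itv clamp01_ge0 clamp01_le1 clamp01_le.
by apply: le_lt_trans (clamp01_contract xy) _; rewrite ltrBlDl.
Unshelve. all: by end_near. Qed.

Let f : cumulative R R := HB.pack (F \o clamp01)
  (isCumulative.Build R _ R (F \o clamp01)
    clamp01_nondecreasing clamp01_right_continuous).

(** A null set is covered by half-open intervals of total length below the [d] of absolute
    continuity. Finite unions of these have Stieltjes measure at most [e], hence so has the whole
    cover. *)
Lemma stieltjes_dominates : lebesgue_stieltjes_measure f `<< @lebesgue_measure R.
Proof.
apply/null_content_dominatesP => A mA A0; apply/eqP.
rewrite eq_le measure_ge0 andbT; apply/lee_addgt0Pr => e e0; rewrite add0e.
have [d d0 dP] := Fac e0.
have [G [mG AG] Gd] : exists2 G, measurable_cover (T := ocitv_type R) A G &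
    (\sum_(k <oo) wlength idfun (G k) < d%:E)%E.
  have Aext : mu_ext (wlength idfun) (A : set (ocitv_type R)) = 0%E by exact: A0.
  have [|_ [G AG <-]] := lb_ereal_inf_adherent (S :=
      [set (\sum_(k <oo) wlength idfun (A' k))%E |
        A' in measurable_cover (A : set (ocitv_type R))]) d0.
    by rewrite -/(mu_ext _ _) Aext.
  by rewrite -/(mu_ext _ _) Aext add0e => Gd; exists G.
pose U n := \big[setU/set0]_(k < n) G k.
have mGR k : measurable (G k : set (measurableTypeR R)).
  by apply: sub_sigma_algebra; exact: mG.
have mU n : measurable (U n : set (measurableTypeR R)) by exact: bigsetU_measurable.
have Ue n : (lebesgue_stieltjes_measure f (U n) <= e%:E)%E.
  have [L [Ls L12 LE]] := ocitv_bigsetU_seq n mG.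
  rewrite LE sumEFin lee_fin.
  pose cl (p : R * R) := (clamp01 p.1, clamp01 p.2).
  have := dP [seq cl p | p <- L]; rewrite !big_map; apply.
  - apply/allP => _ /mapP[p /(allP L12) p12 ->].
    by rewrite /in_unit_itv clamp01_ge0 clamp01_le1 clamp01_le// ltW.
  - rewrite pairwise_map; apply: sub_pairwise Ls => p q /orP[h|h].
      by rewrite /= /nonoverlapping clamp01_le.
    by rewrite /= /nonoverlapping [X in _ || X]clamp01_le// orbT.
  - rewrite -lte_fin; apply: le_lt_trans Gd.
    apply: (@le_trans _ _ (@lebesgue_measure R (U n))).
      (* Lebesgue measure is the Stieltjes measure of [idfun], so the list [L] also computes the
         length of [U n]. *)
      have -> : lebesgue_measure (U n) = _ := LE idfun.
      rewrite sumEFin lee_fin big_seq [leRHS]big_seq; apply: ler_sum => p pL.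
      by apply: clamp01_contract; rewrite ltW// (allP L12).
    apply: ereal_inf_lbound; exists G => //; split => //.
    exact: bigsetU_bigcup.
have mUG : measurable (\bigcup_n U n : set (measurableTypeR R)).
  exact: bigcupT_measurable.
apply: (@le_trans _ _ (lebesgue_stieltjes_measure f (\bigcup_n U n))).
  apply: le_measure; [exact: mem_set|exact: mem_set|].
  apply: subset_trans AG _ => x [k _ Gx]; exists k.+1 => //.
  exact: bigsetU_sup Gx.
have Ucvg : lebesgue_stieltjes_measure f \o U @ \oo -->
    lebesgue_stieltjes_measure f (\bigcup_n U n).
  apply: nondecreasing_cvg_mu => //.
  apply/nondecreasing_seqP => n; rewrite /U big_ord_recr.
  exact/subsetPset/subsetUl.
by apply: cvge_le Ucvg; exact: nearW.
Qed.

Lemma monotone_ac_density : exists phi : R -> R,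
  (@lebesgue_measure R).-integrable setT (EFin \o phi) /\
  forall x y, 0 <= x -> x <= y -> y <= 1 ->
    (\int[lebesgue_measure]_(t in `]x, y]) (phi t)%:E = (F y - F x)%:E)%E.
Proof.
have fE x y : 0 <= x -> x <= y -> y <= 1 ->
    lebesgue_stieltjes_measure f `]x, y]%classic = (F y - F x)%:E.
  move=> x0 xy y1; rewrite lebesgue_stieltjes_itvoc//.
  by rewrite /f/= !clamp01_id// ?(le_trans xy)// (le_trans x0).
have m01 : measurable (`]0, 1]%classic : set (measurableTypeR R)).
  exact: measurable_itv.
have fin01 : (lebesgue_stieltjes_measure f `]0%R, 1%R]%classic < +oo)%E.
  by rewrite fE// ltry.
(* Restricting to ]0, 1] gives the finite measure to which Radon-Nikodym applies. *)
pose nu : {finite_measure set (measurableTypeR R) -> \bar R} := mfrestr m01 fin01.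
have [] := @radon_nikodym_sigma_finite _ _ _ (@lebesgue_measure R) nu.
  apply/null_content_dominatesP => A mA A0.
  have /null_content_dominatesP/(_ A mA A0) := stieltjes_dominates.
  move=> fA0; apply/eqP; rewrite eq_le measure_ge0 andbT -fA0.
  apply: le_measure; last exact: subIsetl; apply: mem_set => //.
  exact: measurableI.
move=> phi [phi0 phifin phiint phiE].
exists (fine \o phi); have -> : EFin \o (fine \o phi) = phi.
  by apply/funext => x /=; rewrite fineK.
split => // x y x0 xy y1.
under eq_integral do rewrite fineK//.
rewrite -phiE; last exact: measurable_itv.
rewrite -fE// /nu/= /mfrestr /mrestr setIidl//.
move=> t /=; rewrite !in_itv/= => /andP[xt ty].
by rewrite (le_lt_trans x0 xt) (le_trans ty).
Qed.
End Density.

Lemma integrable_itv01 (h : R -> R) (i : interval R) :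
  [set` i] `<=` `[0, 1]%classic -> mu.-integrable `[0, 1] (EFin \o h) ->
  mu.-integrable [set` i] (EFin \o h).
Proof. by move=> ?; apply: integrableS => //; exact: measurable_itv. Qed.

Lemma ac_density g : abs_continuous 0 1 g -> exists psi : R -> R,
  mu.-integrable setT (EFin \o psi) /\
  forall x y, 0 <= x -> x <= y -> y <= 1 ->
    \int[mu]_(t in `]x, y]) psi t = g y - g x.
Proof.
move=> /ac_sub_monotone[F [Fac Gac gF]].
have [|phi [iphi phiE]] := monotone_ac_density _ Fac.
  by move=> x y x0 xy y1; rewrite -subr_ge0; apply: le_trans (gF x y x0 xy y1).
have [|gam [igam gamE]] := monotone_ac_density _ Gac.
  move=> x y x0 xy y1; have := le_trans (ler_norm _) (gF x y x0 xy y1).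
  lra.
exists (fun x => phi x - gam x); split.
  have -> : EFin \o (fun x => phi x - gam x) =
    ((EFin \o phi) \- (EFin \o gam))%E by [].
  exact: integrableB.
move=> x y x0 xy y1; rewrite RintegralB//.
- by rewrite /Rintegral phiE// gamE//=; ring.
- exact: (integrableS measurableT).
- exact: (integrableS measurableT).
Qed.

(** At interior points [derive_in] is the ordinary derivative, and near them [g] is a constant plus
    the integral of [psi], which Lebesgue's theorem differentiates almost everywhere. The two end
    points form a null set. *)
Lemma ac_derive_ae g psi : mu.-integrable setT (EFin \o psi) ->
  (forall x y, 0 <= x -> x <= y -> y <= 1 ->
    \int[mu]_(t in `]x, y]) psi t = g y - g x) ->
  ae_eq mu (`[0, 1]%classic : set (measurableTypeR R)) (derive_in `[0, 1] g) psi.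
Proof.
move=> ipsi psiE.
have ioc y : mu.-integrable [set` Interval (BRight 0) (BRight y)] (EFin \o psi).
  by apply: integrableS ipsi => //; exact: measurable_itv.
have ftc := FTC1 ioc (open_integrable_locally openT ipsi).
have ae01 : {ae mu, forall x : R, x != 0 /\ x != 1}.
  exists ([set 0] `|` [set 1]); split.
  - exact: measurableU.
  - by rewrite measureU0//; exact: lebesgue_measure_set1.
  - move=> x /= /not_andP[|] /negP; rewrite negbK => /eqP ->; [by left|by right].
move: ftc ae01; apply: filterS2; first exact: (ae_filter_ringOfSetsType mu).
move=> x /= ftcx [x0 x1].
rewrite in_itv/= => /andP[x0' x1'].
have x0lt : 0 < x by rewrite lt_neqAle eq_sym x0.
have x1lt : x < 1 by rewrite lt_neqAle x1.
have [dx dxE] := ftcx x0lt.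
rewrite derive_inE; last first.
  by rewrite interior_itv/= in_itv/= x0lt.
have gE y : 0 <= y -> y <= 1 ->
    g y = (cst (g 0) \+ (fun y => \int[mu]_(t in `]0, y]) psi t)) y.
  by move=> y0 y1 /=; rewrite psiE// [RHS]addrC subrK.
rewrite -dxE !derive1E.
transitivity ('D_1 (cst (g 0) \+ (fun y => \int[mu]_(t in `]0, y]) psi t)) x).
  apply: near_eq_derive; near=> y; apply: gE.
  - by apply/ltW; near: y; exact: lt_nbhsr.
  - by apply/ltW; near: y; exact: lt_nbhsl.
rewrite deriveD; [|exact: derivable_cst|exact: dx].
by rewrite derive_cst add0r.
Unshelve. all: by end_near. Qed.

(* [derive_in] takes its junk value on a null set only, see [ac_derive_ae]. *)
Lemma ac_ftc g (h := derive_in `[0, 1] g) : abs_continuous 0 1 g ->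
  measurable_fun (`[0, 1]%classic : set (measurableTypeR R)) h ->
  mu.-integrable `[0, 1] (EFin \o h) /\
  forall x y, 0 <= x -> x <= y -> y <= 1 -> \int[mu]_(t in `[x, y]) h t = g y - g x.
Proof.
move=> /ac_density[psi [ipsi psiE]] mh.
have aeq := ac_derive_ae ipsi psiE.
have aeqE : ae_eq mu (`[0, 1]%classic : set (measurableTypeR R))
    (EFin \o h) (EFin \o psi).
  by apply: filterS aeq => x /= + x01; rewrite -/h => ->.
have ih : mu.-integrable `[0, 1] (EFin \o h).
  have /integrableP[mpsi psioo] : mu.-integrable `[0, 1] (EFin \o psi).
    by apply: integrableS ipsi => //; exact: measurable_itv.
  apply/integrableP; split; first exact/measurable_EFinP.
  apply: le_lt_trans psioo; rewrite le_eqVlt; apply/orP; left; apply/eqP.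
  apply: ae_eq_integral => //.
  - by apply: measurableT_comp => //; exact/measurable_EFinP.
  - exact: measurableT_comp.
  - by apply: filterS aeqE => x /= hx x01; case: (hx x01) => ->.
split => // x y x0 xy y1.
have sub : `[x, y]%classic `<=` (`[0, 1]%classic : set R).
  by apply: subset_itv; rewrite bnd_simp.
have subo : `]x, y]%classic `<=` (`[0, 1]%classic : set R).
  by apply: subset_itv; rewrite bnd_simp.
rewrite -psiE// -Rintegral_itv_obnd_cbnd; last exact: integrable_itv01.
rewrite /Rintegral; congr fine; apply: ae_eq_integral => //.
- apply/measurable_EFinP; exact: measurable_funS mh.
- by have /integrableP[+ _] := ipsi; exact: measurable_funS.
- exact: ae_eq_subset aeqE.
Qed.

Lemma ac_continuous (g : R -> R) : abs_continuous 0 1 g ->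
  {within `[0, 1]%classic, continuous g}.
Proof.
move=> gac; apply/subspace_continuousP => x /=; rewrite in_itv/= => /andP[x0 x1].
apply/cvgrPdist_lt => e e0; have [d d0 dP] := ac_seq gac e0.
have seg (y z : R) : 0 <= y -> y <= z -> z <= 1 -> z - y < d -> `|g z - g y| < e.
  move=> y0 yz z1 zyd; have := dP [:: (y, z)]; rewrite !big_seq1; apply => //.
  by rewrite all_seq1 /in_unit_itv y0 yz z1.
near=> y.
have /andP[y0 y1] : 0 <= y <= 1.
  near: y; exact: withinT.
have yd : `|x - y| < d.
  near: y; apply: cvg_within; exact: (nbhsx_ballx x d d0).
have [xy|/ltW yx] := leP x y.
  rewrite distrC; apply: seg => //; by rewrite distrC ger0_norm ?subr_ge0 in yd.
by apply: seg => //; rewrite ger0_norm ?subr_ge0 in yd.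
Unshelve. all: by end_near. Qed.

Lemma ac_integrable (g : R -> R) : abs_continuous 0 1 g ->
  mu.-integrable `[0, 1] (EFin \o g).
Proof.
move=> /ac_continuous; apply: continuous_compact_integrable; exact: segment_compact.
Qed.

Lemma sobolev_ftc r (f : R -> R) s (g := derive_in_n `[0, 1] s f)
    (h := derive_in_n `[0, 1] s.+1 f) : sobolev r f -> (s < r)%N ->
  mu.-integrable `[0, 1] (EFin \o h) /\
  forall x y, 0 <= x -> x <= y -> y <= 1 -> \int[mu]_(t in `[x, y]) h t = g y - g x.
Proof.
move=> [fac _ fr] sr; apply: ac_ftc; first exact: fac.
(* Measurability of [h]: below the top order [h] is absolutely continuous, at the top order it
   belongs to L2. *)
have [sr'|] := ltnP s.+1 r.
  by have /integrableP[/measurable_EFinP] := ac_integrable (fac _ sr').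
move=> rs; have rE : r = s.+1 by apply/eqP; rewrite eqn_leq rs sr.
apply/(measurable_restrictT _ (measurable_itv _)).
by move: fr; rewrite rE => /sub_Lfun_mfun/set_mem.
Qed.

End AbsoluteContinuity.

(** * Expansions in base b *)

Section MuSeq.
Local Open Scope nat_scope.

(* [mu_per] as a function of the positions a_1 > ... > a_v; the cases r = 0 and
   k = 0 need not be singled out here, see [mu_perE]. *)
Definition mu_seq r (s : seq nat) :=
  if size s < r then sumn s + (r - size s) * last 0 s else sumn (take r s).

Lemma mu_seq0 s : mu_seq 0 s = 0.
Proof. by rewrite /mu_seq take0. Qed.

(** [mu_seq] adds the first r terms of the sequence prolonged by its last entry; hence a lone [a]
    remains as its own tail. *)
Lemma mu_seqS r a s :
  mu_seq r.+1 (a :: s) = a + mu_seq r (if nilp s then [:: a] else s).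
Proof.
case: s => [|c s] /=; last first.
  by rewrite /mu_seq /= ltnS subSS; case: ifP; rewrite ?addnA.
by case: r => [|[|r]]; rewrite /mu_seq /= ?take0 /=; lia.
Qed.

(** Term by term, the prolonged decreasing sequence [a :: s] dominates the prolonged [s], strictly
    at the first term. *)
Lemma mu_seq_le r a s : sorted gtn (a :: s) -> ~~ nilp s ->
  mu_seq r s <= mu_seq r (a :: s) /\ (0 < r -> mu_seq r s < mu_seq r (a :: s)).
Proof.
case: s => // c s; elim: r a c s => [|r IH] a c s; first by rewrite !mu_seq0.
move=> /andP[/= ca ss] _; rewrite !mu_seqS /=.
suff h : mu_seq r (if nilp s then [:: c] else s) <= mu_seq r (c :: s).
  by move: ca h; rewrite /gtn/=; lia.
by case: s ss => //= d s ss; case: (IH c d s).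
Qed.

(** The strict case is the source of the extra factor 1/b in the induction when k has at least two
    nonzero digits. *)
Lemma mu_seq_le2 r a s : sorted gtn (a :: s) ->
  mu_seq r.+1 (a :: s) <= a + mu_seq r (a :: s) /\
  (0 < r -> ~~ nilp s -> mu_seq r.+1 (a :: s) < a + mu_seq r (a :: s)).
Proof.
move=> ss; rewrite mu_seqS; case: s ss => [|c s] ss /=; first by split.
by have [] := @mu_seq_le r a (c :: s) ss isT; lia.
Qed.

End MuSeq.

Section Digits.
Local Open Scope nat_scope.
Variable b : nat.
Hypothesis b1 : 1 < b.

Lemma ndigit_ge k a : k < b ^ a.-1 -> ndigit b k a = 0.
Proof. by move=> kb; rewrite /ndigit divn_small// mod0n. Qed.

Lemma positions_wide k n : k < b ^ n ->
  positions b k = [seq a <- rev (iota 1 n) | 0 < ndigit b k a].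
Proof.
have wide m p : k < b ^ m ->
    [seq a <- rev (iota 1 (m + p)) | 0 < ndigit b k a] =
    [seq a <- rev (iota 1 m) | 0 < ndigit b k a].
  move=> km; rewrite iotaD rev_cat filter_cat -[RHS]cat0s; congr (_ ++ _).
  apply/eqP; rewrite -size_eq0 size_filter -leqn0 leqNgt -has_count.
  apply/hasPn => a; rewrite mem_rev mem_iota => /andP[ma _].
  rewrite ndigit_ge// (leq_trans km)// leq_exp2l//.
  by case: a ma => //= a; rewrite add1n ltnS.
move=> kn; rewrite /positions; have kk := ltn_expl k b1.
have [kn'|/ltnW kn'] := leqP k n.
  by have := wide k (n - k) kk; rewrite subnKC.
by have := wide n (k - n) kn; rewrite subnKC.
Qed.

Section Top.
Variables a kap k' : nat.
Hypotheses (a0 : 0 < a) (kap0 : 0 < kap) (kapb : kap < b) (k'a : k' < b ^ a.-1).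

Lemma ndigit_top : ndigit b (kap * b ^ a.-1 + k') a = kap.
Proof.
by rewrite /ndigit divnMDl ?expn_gt0 ?(ltnW b1)// divn_small// addn0 modn_small.
Qed.

Lemma ndigit_below p : 0 < p < a ->
  ndigit b (kap * b ^ a.-1 + k') p = ndigit b k' p.
Proof.
move=> /andP[p0 pa]; rewrite /ndigit.
have -> : b ^ a.-1 = b ^ (a - p) * b ^ p.-1 by rewrite -expnD; congr (_ ^ _); lia.
rewrite mulnA divnMDl ?expn_gt0 ?(ltnW b1)//.
rewrite -(subnSK pa) expnSr mulnA -modnDml modnMl add0n //.
Qed.

Lemma expn_top : kap * b ^ a.-1 + k' < b ^ a.
Proof.
rewrite -{2}(prednK a0) expnS; apply: (@leq_trans (kap.+1 * b ^ a.-1)).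
  by rewrite mulSn addnC ltn_add2r.
by rewrite leq_mul2r kapb orbT.
Qed.

Lemma positions_top :
  positions b (kap * b ^ a.-1 + k') = a :: positions b k'.
Proof.
rewrite (positions_wide expn_top) (positions_wide k'a).
have -> : iota 1 a = rcons (iota 1 a.-1) a.
  case: (a) a0 => //= m _.
  by rewrite -cats1 -[m.+1 in RHS]add1n -(iotaD 1 m 1) addn1.
rewrite rev_rcons /=.
rewrite ndigit_top kap0; congr (_ :: _).
apply: eq_in_filter => p; rewrite mem_rev mem_iota => pa.
by rewrite ndigit_below//; move: pa a0; lia.
Qed.

End Top.

Lemma leading_digitP k : 0 < k -> exists a kap k', [/\ 0 < a, 0 < kap, kap < b,
  k' < b ^ a.-1 & k = kap * b ^ a.-1 + k'].
Proof.
move=> k0; pose t := trunc_log b k.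
have /andP[lo hi] := trunc_log_bounds b1 k0.
have bt : 0 < b ^ t by rewrite expn_gt0 (ltnW b1).
exists t.+1, (k %/ b ^ t), (k %% b ^ t); split => //=.
- by rewrite divn_gt0.
- by rewrite ltn_divLR// -expnS.
- exact: ltn_pmod.
- exact: divn_eq.
Qed.

Lemma positions_nil k : (positions b k == [::]) = (k == 0).
Proof.
have [->//|k0] := posnP k.
have [a [kap [k' [a0 kap0 kapb k'a ->]]]] := leading_digitP k0.
by rewrite positions_top.
Qed.

Lemma positions_lt k n p : k < b ^ n -> p \in positions b k -> 0 < p <= n.
Proof.
move=> kn; rewrite (positions_wide kn) mem_filter mem_rev mem_iota => /andP[_].
by rewrite add1n ltnS.
Qed.

(** The digits are a parameter [d], so that points and grid cells share one exponent. *)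
Definition walsh_exp k (d : nat -> nat) :=
  \sum_(a <- positions b k) ndigit b k a * d a.

Lemma eq_walsh_exp k n (d d' : nat -> nat) : k < b ^ n ->
  (forall p, 0 < p <= n -> d p = d' p) -> walsh_exp k d = walsh_exp k d'.
Proof.
move=> kn dd'; rewrite /walsh_exp big_seq [RHS]big_seq.
by apply: eq_bigr => p /(positions_lt kn) /dd' ->.
Qed.

Lemma walsh_exp_top a kap k' d : 0 < a -> 0 < kap -> kap < b -> k' < b ^ a.-1 ->
  walsh_exp (kap * b ^ a.-1 + k') d = kap * d a + walsh_exp k' d.
Proof.
move=> a0 kap0 kapb k'a; rewrite /walsh_exp positions_top// big_cons ndigit_top//.
congr (_ + _); rewrite big_seq [RHS]big_seq; apply: eq_bigr => p.
move=> /(positions_lt k'a) pa; rewrite ndigit_below//; move: pa a0; lia.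
Qed.

Lemma mu_perE r k : mu_per b r k = mu_seq r (positions b k).
Proof.
rewrite /mu_per /mu_seq; have [->|] := posnP r; first by rewrite take0.
by have [->|] := posnP k; rewrite //= muln0 if_same.
Qed.

End Digits.

(** * Discrete Walsh functions *)

Section Fourier.
Variables (K : numFieldType) (b : nat) (eta : K).
Hypotheses (b1 : (1 < b)%N) (etaP : b.-primitive_root eta).

(** The Fourier coefficient at t of the identity on the residues 0, ..., b - 1, see
    [digit_fourier]. *)
Definition fourier_coeff (t : nat) : K := ((eta ^+ t)^-1 - 1)^-1.

Lemma eta_neq0 : eta != 0.
Proof. by rewrite (prim_root_eq0 etaP) -lt0n ltnW. Qed.

Lemma etaX_neq1 t : (0 < t < b)%N -> eta ^+ t != 1.
Proof.
move=> /andP[t0 tb]; rewrite -(prim_order_dvd etaP).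
by apply/negP => /(dvdn_leq t0); rewrite leqNgt tb.
Qed.

Lemma inv_pair (z : K) : z != 0 -> z != 1 -> (z^-1 - 1)^-1 + (z - 1)^-1 = -1.
Proof.
move=> z0; rewrite -subr_eq0 => z1; have -> : z^-1 - 1 = - ((z - 1) / z) by field.
by rewrite invrN invf_div; field.
Qed.

Lemma inv_step (z : K) y : z != 0 -> z != 1 ->
  (z^-1 - 1)^-1 * (z * y) - (z^-1 - 1)^-1 * y = - (z * y).
Proof.
move=> z0; rewrite -subr_eq0 => z1; have -> : z^-1 - 1 = - ((z - 1) / z) by field.
by rewrite invrN invf_div; field.
Qed.

Lemma sum_eta_powers d : (0 < d < b)%N -> \sum_(1 <= t < b) eta ^+ (t * d) = -1.
Proof.
move=> db; have /eqP : \sum_(i < b) (eta ^+ d) ^+ i = 0.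
  have /eqP := subrX1 (eta ^+ d) b.
  rewrite -exprM mulnC exprM (prim_expr_order etaP) expr1n subrr eq_sym mulf_eq0.
  by rewrite subr_eq0 (negbTE (etaX_neq1 db)) => /eqP.
rewrite -(big_mkord xpredT (fun i => (eta ^+ d) ^+ i)) big_ltn ?(ltnW b1)// expr0.
rewrite addrC addr_eq0 => /eqP <-.
by apply: eq_bigr => t _; rewrite -exprM mulnC.
Qed.

(** The terms t and b - t belong to inverse roots of unity and add up to -1. *)
Lemma sum_fourier_coeff : \sum_(1 <= t < b) fourier_coeff t = - ((b%:R - 1) / 2).
Proof.
have rev : \sum_(1 <= t < b) fourier_coeff t =
    \sum_(1 <= t < b) fourier_coeff (b - t).
  rewrite big_nat_rev /= add1n; apply: eq_big_nat => t _.
  by rewrite subSS.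
have two : 2 * \sum_(1 <= t < b) fourier_coeff t = - (b%:R - 1).
  rewrite mulr_natl mulr2n {2}rev -big_split /=.
  rewrite (eq_big_nat _ _ (F2 := fun=> -1)); last first.
    move=> t tb; rewrite /fourier_coeff.
    have nz := etaX_neq1 tb.
    have nz0 : eta ^+ t != 0 by rewrite expf_neq0// eta_neq0.
    have -> : eta ^+ (b - t) = (eta ^+ t)^-1.
      apply: (mulfI nz0); rewrite divff// -exprD subnKC ?(prim_expr_order etaP)//.
      by case/andP: tb => _ /ltnW.
    by rewrite invrK inv_pair.
  by rewrite sumr_const_nat mulNrn natrB ?(ltnW b1).
by rewrite -mulNr -two; field.
Qed.

(** By induction on d: from d to d + 1 the t-th term changes by [- eta ^+ (t * d.+1)], and these
    changes add up to 1. *)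
Lemma digit_fourier d : (d < b)%N ->
  d%:R = (b%:R - 1) / 2 + \sum_(1 <= t < b) fourier_coeff t * eta ^+ (t * d).
Proof.
elim: d => [_|d IH db].
  under eq_bigr do rewrite muln0 expr0 mulr1.
  by rewrite sum_fourier_coeff subrr.
rewrite -natr1 IH ?(ltnW db)// -addrA; congr (_ + _).
apply/esym/eqP; rewrite addrC -subr_eq; apply/eqP; apply: oppr_inj.
rewrite -(@sum_eta_powers d.+1)//.
rewrite opprB -sumrB; apply: eq_big_nat => t tb.
rewrite mulnS exprD; apply: oppr_inj; rewrite opprB inv_step//.
  by rewrite expf_neq0// eta_neq0.
exact: etaX_neq1.
Qed.

End Fourier.

Section DiscreteWalsh.
Variables (K : numFieldType) (b : nat) (eta : K).
Hypotheses (b1 : (1 < b)%N) (etaP : b.-primitive_root eta).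
Let b0 : (0 < b)%N := ltnW b1.
Let bX0 m : (0 < b ^ m)%N. Proof. by rewrite expn_gt0 b0. Qed.
Let bR0 : b%:R != 0 :> K. Proof. by rewrite pnatr_eq0 -lt0n. Qed.

(* The p-th digit of any x in [j / b^n, (j + 1) / b^n), see [rdigit_cell]. *)
Definition cell_digit n j p : nat := ((j %/ b ^ (n - p)) %% b)%N.

(* The value on that cell of the conjugate of wal_k, see [conj_wal_cell]. *)
Definition dwalsh n k j : K := eta ^+ walsh_exp b k (cell_digit n j).

Section Prefix.
Variables n a kap k' : nat.
Hypotheses (a0 : (0 < a)%N) (an : (a <= n)%N) (kap0 : (0 < kap)%N)
  (kapb : (kap < b)%N) (k'a : (k' < b ^ a.-1)%N).
Let k := (kap * b ^ a.-1 + k')%N.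
Let B := (b ^ (n - a))%N.

Lemma cell_digit_block j p : (0 < p <= a)%N ->
  cell_digit n j p = ((j %/ B %/ b ^ (a - p)) %% b)%N.
Proof.
move=> /andP[p0 pa]; by rewrite /cell_digit -divnMA -expnD addnBA// subnK.
Qed.

Lemma dwalsh_top j :
  dwalsh n k j = eta ^+ kap ^+ (j %/ B %% b) * dwalsh n k' j.
Proof.
rewrite /dwalsh walsh_exp_top// exprD cell_digit_block ?a0 ?leqnn//.
by rewrite subnn expn0 divn1 exprM.
Qed.

(** [k'] involves only digits before the a-th, and these are constant on blocks of [B * b] cells. *)
Lemma dwalsh_below i j : (i %/ B %/ b = j %/ B %/ b)%N ->
  dwalsh n k' i = dwalsh n k' j.
Proof.
move=> ij; congr (_ ^+ _); apply: (eq_walsh_exp b1 k'a) => p /andP[p0 pa].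
have pa' : (0 < p <= a)%N by rewrite p0 (leq_trans pa) ?leq_pred.
rewrite !cell_digit_block//.
have -> : (b ^ (a - p) = b * b ^ (a.-1 - p))%N by rewrite -expnS -subSn// prednK.
by rewrite !divnMA ij.
Qed.

(* The left-hand side is b^n times the value at j / b^n of the primitive of the
   conjugate of wal_k. *)
Lemma sum_dwalsh j : \sum_(0 <= i < j) dwalsh n k i =
  B%:R * (1 - eta ^+ kap)^-1 * (dwalsh n k' j - dwalsh n k j)
  + (j %% B)%:R * dwalsh n k j.
Proof.
have z1 : 1 - eta ^+ kap != 0 by rewrite subr_eq0 eq_sym (etaX_neq1 etaP)// kap0.
have z0 : eta ^+ kap != 0 by rewrite expf_neq0// (eta_neq0 b1 etaP).
have B0 : (0 < B)%N := bX0 _.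
have zb : (eta ^+ kap) ^+ b = 1.
  by rewrite -exprM mulnC exprM (prim_expr_order etaP) expr1n.
elim: j => [|j IH].
  rewrite big_nil !dwalsh_top !div0n mod0n expr0 mod0n mul1r subrr mulr0 mul0r.
  by rewrite addr0.
rewrite big_nat_recr//= IH; set z := eta ^+ kap in z1 zb z0 *.
(* Three cases: j + 1 stays in its block of [B] cells; it enters a new one and the a-th digit
   increases by one; or that digit falls from b - 1 to 0. In the last case [z ^+ b = 1] makes the
   sum vanish. *)
have [Bj|Bj] := boolP (B %| j.+1)%N; last first.
  have dj : (j.+1 %/ B = j %/ B)%N by rewrite divnS// (negbTE Bj).
  have mj : (j.+1 %% B = (j %% B).+1)%N by rewrite modnS (negbTE Bj).
  rewrite !dwalsh_top (dwalsh_below (i := j.+1) (j := j)) ?dj//.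
  by rewrite mj -natr1; ring.
have dj : (j.+1 %/ B = (j %/ B).+1)%N by rewrite divnS// Bj.
have mj : (j.+1 %% B = 0)%N by apply/eqP.
have mj' : ((j %% B)%:R = B%:R - 1 :> K).
  apply/eqP; rewrite eq_sym subr_eq natr1 eqr_nat; apply/eqP.
  apply: (@addnI (j %/ B * B)%N); rewrite addnS -divn_eq [LHS]addnC.
  by rewrite [RHS](divn_eq _ B) mj dj addn0 mulSn.
rewrite mj mul0r addr0 mj'.
rewrite !dwalsh_top dj.
have [bi|bi] := boolP (b %| (j %/ B).+1)%N; last first.
  have di : ((j %/ B).+1 %% b = (j %/ B %% b).+1)%N by rewrite modnS (negbTE bi).
  rewrite (dwalsh_below (i := j.+1) (j := j)) ?dj ?di; last first.
    by rewrite divnS// (negbTE bi).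
  by rewrite exprS -/z; field.
have -> : ((j %/ B).+1 %% b = 0)%N by apply/eqP.
have -> : (j %/ B %% b = b.-1)%N.
  by rewrite -[(j %/ B)%N]/((j %/ B).+1.-1) modn_pred ?bi// gtn_eqF.
have zb' : z ^+ b.-1 = z^-1.
  apply: (mulIf z0); rewrite mulVf// -exprSr prednK//.

rewrite zb' -/z expr0 mul1r subrr mulr0; field.
by rewrite z0 z1.
Qed.

End Prefix.
End DiscreteWalsh.

(** * Higher frequencies in the primitive and summation by parts *)

Section DiscreteWalsh.
Variables (K : numFieldType) (b : nat) (eta : K).
Hypotheses (b1 : (1 < b)%N) (etaP : b.-primitive_root eta).
Let b0 : (0 < b)%N := ltnW b1.
Let bX0 m : (0 < b ^ m)%N. Proof. by rewrite expn_gt0 b0. Qed.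
Let bR0 : b%:R != 0 :> K. Proof. by rewrite pnatr_eq0 -lt0n. Qed.
Local Notation W := (dwalsh b eta).

Lemma modn_digits j m :
  (j %% b ^ m = \sum_(0 <= i < m) b ^ i * ((j %/ b ^ i) %% b))%N.
Proof.
elim: m => [|m IH]; first by rewrite big_nil expn0 modn1.
rewrite big_nat_recr//= -IH expnSr.
set q := (j %/ b ^ m)%N; set t := (j %% b ^ m)%N.
have jE : (j = (q %/ b) * (b ^ m * b) + (t + b ^ m * (q %% b)))%N.
  rewrite {1}(divn_eq j (b ^ m)) -/q -/t {1}(divn_eq q b); lia.
rewrite {1}jE modnMDl modn_small//.
have tb : (t < b ^ m)%N by rewrite ltn_pmod.
have qb : (q %% b < b)%N by rewrite ltn_pmod.
apply: (@leq_trans (b ^ m * (q %% b).+1)); first by rewrite mulnS ltn_add2r.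
by rewrite leq_mul2l qb orbT.
Qed.

Lemma frac_digits j a m :
  (j %% b ^ m)%:R / (b ^ m)%:R =
  \sum_(1 <= c < m.+1) b%:R ^- c * (cell_digit b (a + m) j (a + c))%:R :> K.
Proof.
rewrite modn_digits natr_sum mulr_suml big_nat_rev /= add0n big_add1 /=.
apply: eq_big_nat => c /andP[_ cm].
rewrite /cell_digit natrM mulrAC; congr (_ * _); last by rewrite subnDl.
rewrite -{2}(subnK cm) expnD !natrX natrM !natrX invfM mulrA divff ?mul1r//.
by rewrite expf_neq0.
Qed.

Lemma sum_inv_expn m :
  \sum_(1 <= c < m.+1) b%:R ^- c * ((b%:R - 1) / 2) = (1 - b%:R ^- m) / 2 :> K.
Proof.
elim: m => [|m IH]; first by rewrite big_geq// expr0 invr1 subrr mul0r.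
by rewrite big_nat_recr//= IH exprS; field; rewrite bR0 expf_neq0.
Qed.

Section Expansion.
Variables n a kap k' : nat.
Hypotheses (a0 : (0 < a)%N) (an : (a <= n)%N) (kap0 : (0 < kap)%N)
  (kapb : (kap < b)%N) (k'a : (k' < b ^ a.-1)%N).
Let k := (kap * b ^ a.-1 + k')%N.
Let m := (n - a)%N.
(* The indices of the higher frequencies in the expansion of the primitive of
   the conjugate of wal_k. *)
Definition walsh_child c t := (t * b ^ (a + c).-1 + k)%N.

Lemma expn_child c : (0 < c)%N -> (k < b ^ (a + c).-1)%N.
Proof.
move=> c0; apply: (leq_trans (expn_top a0 kapb k'a)).
rewrite leq_exp2l// -ltnS prednK ?addn_gt0 ?a0//.
by rewrite -[X in (X < _)%N]addn0 ltn_add2l.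
Qed.

Lemma dwalsh_child j c t : (0 < c)%N -> (0 < t < b)%N ->
  W n (walsh_child c t) j = eta ^+ (t * cell_digit b n j (a + c)) * W n k j.
Proof.
move=> c0 /andP[t0 tb]; rewrite /dwalsh walsh_exp_top ?exprD ?addn_gt0 ?a0//.
exact: expn_child.
Qed.

(** The fraction is expanded into its digits and each digit into its Fourier series. The oscillating
    terms turn [W n k] into the functions of index [walsh_child c t]; the means (b - 1)/2 add up to
    the first summand. *)
Lemma frac_dwalsh j :
  (j %% b ^ m)%:R / (b ^ m)%:R * W n k j =
  (1 - b%:R ^- m) / 2 * W n k j +
  \sum_(1 <= c < m.+1) b%:R ^- c *
    \sum_(1 <= t < b) fourier_coeff eta t * W n (walsh_child c t) j.
Proof.
rewrite (frac_digits _ a) subnKC// -sum_inv_expn !mulr_suml -big_split /=.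
apply: eq_big_nat => c /andP[c0 cm].
have /(digit_fourier b1 etaP) -> : (cell_digit b n j (a + c) < b)%N.
  by rewrite ltn_pmod.
rewrite mulrDr mulrDl; congr (_ + _).
rewrite -mulrA mulr_suml; congr (_ * _); apply: eq_big_nat => t tb.
by rewrite dwalsh_child// mulrA.
Qed.

(** The index [b ^ n] lies just past the last cell, and all its digits up to n are 0. *)
Lemma dwalsh_end l : (l < b ^ n)%N -> W n l (b ^ n) = 1.
Proof.
move=> ln; rewrite /dwalsh (@eq_walsh_exp _ b1 l n _ (fun=> 0%N))//.
  by rewrite /walsh_exp big1// => i _; rewrite muln0.
move=> p /andP[p0 pn]; rewrite /cell_digit -expnB ?leq_subr//.
by rewrite subKn// -(prednK p0) expnS modnMr.
Qed.

(** When [G j] is the integral of a function over the j-th cell and [l < b ^ n], this is its exact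
    Walsh coefficient, see [walsh_coeff_sum]. *)
Definition dcoeff (G : nat -> K) l := \sum_(0 <= j < b ^ n) W n l j * G j.

(** Abel summation against the primitive [P], which is then expanded by [sum_dwalsh] and
    [frac_dwalsh]. *)
Lemma sum_dwalsh_by_parts (u : nat -> K) (G := fun j => u j.+1 - u j) :
  \sum_(0 <= j < b ^ n) W n k j * u j.+1 = - (b ^ m)%:R *
  ((1 - eta ^+ kap)^-1 * (dcoeff G k' - dcoeff G k)
   + (1 - b%:R ^- m) / 2 * dcoeff G k
   + \sum_(1 <= c < m.+1) b%:R ^- c *
       \sum_(1 <= t < b) fourier_coeff eta t * dcoeff G (walsh_child c t)).
Proof.
pose P j := \sum_(0 <= i < j) W n k i.
have abel N : \sum_(0 <= j < N) W n k j * u j.+1 =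
    P N * u N - \sum_(0 <= j < N) P j * G j.
  elim: N => [|N IH]; first by rewrite !big_geq// /P big_geq// mul0r subrr.
  by rewrite !big_nat_recr//= IH /P big_nat_recr//= /G; ring.
have kn : (k < b ^ n)%N.
  by apply: (leq_trans (expn_top a0 kapb k'a)); rewrite leq_exp2l.
have k'n : (k' < b ^ n)%N.
  by apply: (leq_trans k'a); rewrite leq_exp2l// (leq_trans (leq_pred _) an).
(* As k > 0, the primitive also vanishes at the right end, so no boundary term is left. *)
have PN : P (b ^ n)%N = 0.
  rewrite /P (sum_dwalsh b1 etaP)// !dwalsh_end// subrr mulr0 add0r mulr1.
  by rewrite -(subnK an) expnD -/m addnK modnMr.
rewrite abel PN mul0r sub0r mulNr; congr (- _).
have Bm0 : (b ^ m)%:R != 0 :> K by rewrite natrX expf_neq0.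
transitivity (\sum_(0 <= j < b ^ n) (b ^ m)%:R * (
   ((1 - eta ^+ kap)^-1 * (W n k' j - W n k j)
    + (j %% b ^ m)%:R / (b ^ m)%:R * W n k j) * G j)).
  apply: eq_bigr => j _; rewrite /P (sum_dwalsh b1 etaP)// -/m.
  by move: (_^-1 : K) => A; field.
rewrite -mulr_sumr; congr (_ * _).
under eq_bigr do rewrite frac_dwalsh.
rewrite /dcoeff -sumrB mulr_sumr mulr_sumr.
have -> : \sum_(1 <= c < m.+1) b%:R ^- c * (\sum_(1 <= t < b) fourier_coeff eta t *
     \sum_(0 <= j < b ^ n) W n (walsh_child c t) j * G j) =
   \sum_(0 <= j < b ^ n) (\sum_(1 <= c < m.+1) b%:R ^- c *
    \sum_(1 <= t < b) fourier_coeff eta t * W n (walsh_child c t) j) * G j.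
  under [RHS]eq_bigr do rewrite mulr_suml.
  rewrite exchange_big /=; apply: eq_bigr => c _.
  under [RHS]eq_bigr do rewrite -mulrA mulr_suml.
  rewrite -mulr_sumr; congr (_ * _); rewrite exchange_big /=.
  apply: eq_bigr => t _; rewrite mulr_sumr; apply: eq_bigr => j _.
  by rewrite mulrA.
rewrite -!big_split /=; apply: eq_bigr => j _; ring.
Qed.
End Expansion.
End DiscreteWalsh.

(** * Bounds on the coefficients *)

Section ComplexNorm.
Variable R : realType.
Implicit Types x y z : R[i].

Lemma normc_ge0 z : 0 <= normc z.
Proof. by case: z => u v; rewrite /normc sqrtr_ge0. Qed.

Lemma ler_normcD x y : normc (x + y) <= normc x + normc y.
Proof. exact: le_normcD. Qed.

Lemma normc_opp z : normc (- z) = normc z.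
Proof. exact: normcN. Qed.

Lemma normc_real (u : R) : normc (u%:C)%C = `|u|.
Proof. by rewrite /normc /= expr0n /= addr0 sqrtr_sqr. Qed.

Lemma normc_nat n : normc (n%:R : R[i]) = n%:R.
Proof. by rewrite -(rmorph_nat (real_complex R)) normc_real ger0_norm. Qed.

Lemma normcX z n : normc (z ^+ n) = normc z ^+ n.
Proof. by elim: n => [|n IH]; rewrite ?expr0 ?normc1// !exprS normcM IH. Qed.

Lemma normc_sum (I : Type) (s : seq I) (P : pred I) (F : I -> R[i]) :
  normc (\sum_(i <- s | P i) F i) <= \sum_(i <- s | P i) normc (F i).
Proof.
elim/big_ind2: _ => [|x u y v xu yv|//]; first by rewrite normc0.
by rewrite (le_trans (ler_normcD _ _))// lerD.
Qed.

End ComplexNorm.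

(** * The conjugate root of unity and its sine bounds *)

Section ConjRoot.
Variables (R : realType) (b : nat).
Hypothesis b1 : (1 < b)%N.
Let bR0 : 0 < b%:R :> R. Proof. by rewrite ltr0n ltnW. Qed.

Definition conj_omega : R[i] := conjc (omega R b).
Local Notation eta := conj_omega.
Local Notation theta := (pi / b%:R : R).

Lemma conj_omegaX t :
  eta ^+ t = Complex (cos (t%:R * theta *+ 2)) (- sin (t%:R * theta *+ 2)).
Proof.
elim: t => [|t IH]; first by rewrite mul0r mul0rn cos0 sin0 oppr0 expr0.
have E : t.+1%:R * theta *+ 2 = 2 * pi / b%:R + t%:R * theta *+ 2.
  by rewrite -natr1; ring.
have mulE (c s c' s' : R) :
    Complex c (- s) * Complex c' (- s') =
    Complex (c * c' - s * s') (- (s * c' + c * s')).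
  by apply/eqP; rewrite eq_complex /=; apply/andP; split; apply/eqP; ring.
by rewrite exprS IH E (cosD (2 * pi / b%:R)) (sinD (2 * pi / b%:R)) -mulE.
Qed.

Lemma sin_theta_gt0 t : (0 < t < b)%N -> 0 < sin (t%:R * theta).
Proof.
move=> /andP[t0 tb]; apply: sin_gt0_pi; apply/andP; split.
  by rewrite mulr_gt0 ?ltr0n// divr_gt0// pi_gt0.
by rewrite mulrA ltr_pdivrMr// mulrC ltr_pM2l ?pi_gt0// ltr_nat.
Qed.

(** The sine increases up to pi/2; beyond that, reflection at pi/2 replaces t by b - t. *)
Lemma sin_theta_min t : (0 < t < b)%N -> sin theta <= sin (t%:R * theta).
Proof.
move=> /andP[t0 tb]; have th0 : 0 < theta by rewrite divr_gt0// pi_gt0.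
have p0 : 0 < pi :> R := pi_gt0 R.
have thE : b%:R * theta = pi by rewrite mulrC divfK// gt_eqF.
have th2 : theta <= pi / 2 by rewrite ler_pM2l ?pi_gt0// lef_pV2 ?posrE// ler_nat.
have mono (u : R) : theta <= u -> u <= pi / 2 -> sin theta <= sin u.
  move=> u1 u2; rewrite leNgt ltr_sin ?in_itv /= -?leNgt; first by [].
    by apply/andP; split; lra.
  by apply/andP; split; lra.
have t1 : theta <= t%:R * theta by apply: ler_peMl; [exact: ltW|rewrite ler1n].
have [|tp] := leP (t%:R * theta) (pi / 2); first exact: mono.
have -> : sin (t%:R * theta) = sin (pi - t%:R * theta).
  by rewrite sinB sinpi cospi mul0r mulN1r sub0r opprK.
apply: mono; last lra.
have -> : pi - t%:R * theta = (b - t)%:R * theta.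
  by rewrite natrB ?(ltnW tb)// mulrBl thE.
 apply: ler_peMl; [exact: ltW|by rewrite ler1n subn_gt0].
Qed.

Lemma normc_1_sub_eta t : (0 < t < b)%N ->
  normc (1 - eta ^+ t) = 2 * sin (t%:R * theta).
Proof.
move=> tb; have s0 := sin_theta_gt0 tb.
rewrite conj_omegaX cos_mulr2n sin_mulr2n cos2sin2.
set s := sin _ in s0 *; set c := cos _.
rewrite /normc /=.
have -> : (1 - ((1 - s ^+ 2) *+ 2 - 1)) ^+ 2 + (0 - - (c * s *+ 2)) ^+ 2 =
    (2 * s) ^+ 2.
  have cs : c ^+ 2 = 1 - s ^+ 2 by rewrite /c cos2sin2.
  have -> : (0 - - (c * s *+ 2)) ^+ 2 = c ^+ 2 * s ^+ 2 *+ 4 by ring.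
  by rewrite cs; ring.
by rewrite sqrtr_sqr ger0_norm// mulr_ge0// ltW.
Qed.

Lemma conj_omega_prim : b.-primitive_root eta.
Proof.
apply/andP; split; first exact: ltnW.
apply/forallP => i; apply/eqP; rewrite unity_rootE.
have [->|ib] := eqVneq i.+1 b.
  apply/eqP; rewrite conj_omegaX mulrCA divff ?gt_eqF// mulr1 cos2pi sin2pi oppr0//.
apply/negbTE; apply/negP => /eqP e1.
have ib' : (0 < i.+1 < b)%N.
  by apply/andP; split => //; rewrite ltn_neqAle ib (ltn_ord i).
have := normc_1_sub_eta ib'; rewrite e1 subrr normc0 => /eqP.
by rewrite eq_sym mulf_eq0 pnatr_eq0/= gt_eqF// sin_theta_gt0.
Qed.

Lemma normc_conj_omega : normc eta = 1.
Proof. by rewrite -[eta]expr1 conj_omegaX /normc sqrrN cos2Dsin2 sqrtr1. Qed.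

Definition sin_factor : R := (2 * sin theta)^-1.
Local Notation S := sin_factor.

Lemma sin_theta1_gt0 : 0 < sin theta.
Proof. by have := @sin_theta_gt0 1; rewrite mul1r b1; exact. Qed.

Lemma sin_factor_gt0 : 0 < S.
Proof. by rewrite invr_gt0 mulr_gt0// sin_theta1_gt0. Qed.

Lemma normc_inv_1_sub_eta t : (0 < t < b)%N -> normc (1 - eta ^+ t)^-1 <= S.
Proof.
move=> tb; rewrite normcV normc_1_sub_eta//.
rewrite lef_pV2 ?posrE ?mulr_gt0 ?sin_theta_gt0 ?sin_theta1_gt0//.
by rewrite ler_pM2l// sin_theta_min.
Qed.

Lemma normc_fourier_coeff t : (0 < t < b)%N -> normc (fourier_coeff eta t) <= S.
Proof.
move=> tb; have n1 := normc_inv_1_sub_eta tb.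
have z0 : eta ^+ t != 0 by rewrite expf_neq0// (eta_neq0 b1 conj_omega_prim).
have z1 : 1 - eta ^+ t != 0.
  by rewrite subr_eq0 eq_sym (etaX_neq1 conj_omega_prim).
have -> : fourier_coeff eta t = eta ^+ t * (1 - eta ^+ t)^-1.
  rewrite /fourier_coeff; move: z0 z1; set z := eta ^+ t => z0 z1.
  have -> : z^-1 - 1 = (1 - z) / z by field.
  by rewrite invf_div.
by rewrite normcM normcX normc_conj_omega expr1n mul1r.
Qed.

(** The difference is [(1 - eta ^+ t)^-1] times a factor of modulus at most 1. Taking 1/2 together
    with the inverse thus costs [S] only, rather than [S + 1/2]. *)
Lemma normc_half_sub t : (0 < t < b)%N -> normc (1 / 2 - (1 - eta ^+ t)^-1) <= S.
Proof.
move=> tb; apply: le_trans (normc_inv_1_sub_eta tb).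
have z1 : 1 - eta ^+ t != 0.
  by rewrite subr_eq0 eq_sym (etaX_neq1 conj_omega_prim).
have -> : 1 / 2 - (1 - eta ^+ t)^-1 = - ((1 + eta ^+ t) / 2) * (1 - eta ^+ t)^-1.
  by field.
rewrite normcM normc_opp ler_piMl ?normc_ge0// normcM normcV normc_nat ler_pdivrMr//.
by rewrite mul1r (le_trans (ler_normcD _ _))// normc1 normcX normc_conj_omega expr1n.
Qed.

End ConjRoot.

Section DiscreteBound.
Variables (R : realType) (b : nat).
Hypothesis b1 : (1 < b)%N.
Local Notation eta := (conj_omega R b).
Local Notation S := (sin_factor R b).
Local Notation W := (dwalsh b eta).

Lemma normc_dwalsh n k j : normc (W n k j) = 1.
Proof. by rewrite normcX normc_conj_omega expr1n. Qed.

Variables n a kap k' : nat.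
Hypotheses (a0 : (0 < a)%N) (an : (a <= n)%N) (kap0 : (0 < kap)%N)
  (kapb : (kap < b)%N) (k'a : (k' < b ^ a.-1)%N).
Let k := (kap * b ^ a.-1 + k')%N.
Let m := (n - a)%N.

(** The last summand comes from the [b%:R ^- m / 2] in the expansion. It carries no power of b, so
    it disappears in the limit once everything is scaled by the mesh. *)
Lemma normc_sum_dwalsh_le (u : nat -> R[i]) (v : nat -> R) (U : R)
    (D := dcoeff b eta n (fun j => u j.+1 - u j)) :
  (forall c t, (0 < c <= m)%N -> (0 < t < b)%N ->
    normc (D (walsh_child b a kap k' c t)) <= v c) ->
  \sum_(1 <= c < m.+1) b%:R ^- c * v c <= U ->
  normc (\sum_(0 <= j < b ^ n) W n k j * u j.+1) <=
    b%:R ^+ m * (S * (normc (D k') + normc (D k) + (b%:R - 1) * U))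
    + normc (D k) / 2.
Proof.
move=> vP vU; have bR0 : 0 < b%:R :> R by rewrite ltr0n ltnW.
have kb : (0 < kap < b)%N by rewrite kap0.
have bm0 : b%:R ^+ m != 0 :> R[i] by rewrite expf_neq0// pnatr_eq0 -lt0n ltnW.
rewrite (sum_dwalsh_by_parts b1 (conj_omega_prim R b1) a0 an kap0 kapb k'a) -/D -/m.
set A := (1 - eta ^+ kap)^-1.
set T := \sum_(1 <= c < m.+1) _.
have TU : normc T <= S * ((b%:R - 1) * U).
  apply: (@le_trans _ _ (\sum_(1 <= c < m.+1) b%:R ^- c * ((b%:R - 1) * S * v c))).
    apply: le_trans (normc_sum _ _ _) _; rewrite big_nat [leRHS]big_nat.
    apply: ler_sum => c /andP[c0 cm]; rewrite normcM normcV normcX normc_nat.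
    rewrite ler_pM2l ?invr_gt0 ?exprn_gt0//.
    apply: le_trans (normc_sum _ _ _) _.
    rewrite -mulrA -[b%:R - 1](natrB _ (ltnW b1)) mulr_natl -sumr_const_nat.
    rewrite big_nat [leRHS]big_nat; apply: ler_sum => t tb.
    rewrite normcM ler_pM ?normc_ge0 ?normc_fourier_coeff//.
    by apply: vP => //; rewrite c0.
  rewrite (eq_bigr (fun c => (b%:R - 1) * S * (b%:R ^- c * v c))); last first.
    by move=> c _; rewrite mulrCA.
  rewrite -mulr_sumr mulrA [S * _]mulrC ler_wpM2l//.
  by rewrite mulr_ge0 ?(ltW (sin_factor_gt0 _ _))// subr_ge0 ler1n ltnW.
have -> : - (b ^ m)%:R * (A * (D k' - D k) + (1 - b%:R ^- m) / 2 * D k + T) =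
   - (b%:R ^+ m * (A * D k' + (1 / 2 - A) * D k + T)) + D k / 2.
  by rewrite natrX; field.
apply: le_trans (ler_normcD _ _) _; apply: lerD; last first.
  by rewrite normcM normcV normc_nat.
rewrite normc_opp normcM normcX normc_nat ler_pM2l ?exprn_gt0//.
apply: le_trans (ler_normcD _ _) _; rewrite !mulrDr; apply: lerD => //.
apply: le_trans (ler_normcD _ _) _; apply: lerD.
  by rewrite normcM ler_wpM2r ?normc_ge0// normc_inv_1_sub_eta.
by rewrite normcM ler_wpM2r ?normc_ge0// normc_half_sub.
Qed.

End DiscreteBound.

(** * Walsh coefficients as finite sums *)

Section StepIntegral.
Variable R : realType.
Local Notation mu := (@lebesgue_measure R).

(** Cells are attached one at a time. Integrability of [phi] is obtained along the way, so
    measurability of Walsh functions needs no separate proof. *)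
Lemma step_Rintegral (phi g : R -> R) (w t : nat -> R) N :
  (forall j, t j <= t j.+1) ->
  (forall j x, (j < N)%N -> t j <= x < t j.+1 -> phi x = w j * g x) ->
  mu.-integrable `[t 0%N, t N[ (EFin \o g) ->
  mu.-integrable `[t 0%N, t N[ (EFin \o phi) /\
  \int[mu]_(x in `[t 0%N, t N[) phi x =
    \sum_(0 <= j < N) w j * \int[mu]_(x in `[t j, t j.+1[) g x.
Proof.
move=> tnd; have tmono i j : (i <= j)%N -> t i <= t j.
  by apply: (homo_leq (r := fun x y => x <= y)) => // x y z; exact: le_trans.
elim: N => [|N IH] phiE ig.
  rewrite set_itv_ge ?bnd_simp ?ltxx// big_geq// Rintegral_set0; split => //.
  exact: integrable_set0.
have sub0 : `[t 0%N, t N[%classic `<=` (`[t 0%N, t N.+1[%classic : set R).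
  by apply: subset_itv; rewrite bnd_simp.
have subN : `[t N, t N.+1[%classic `<=` (`[t 0%N, t N.+1[%classic : set R).
  by apply: subset_itv; rewrite bnd_simp// tmono.
have [|ip pE] := IH (fun j x jN => phiE j x (ltnW jN)).
  by apply: integrableS ig => //; exact: measurable_itv.
have igN : mu.-integrable `[t N, t N.+1[ (EFin \o g).
  by apply: integrableS ig => //; exact: measurable_itv.
have iN : mu.-integrable `[t N, t N.+1[ (EFin \o phi).
  have : mu.-integrable `[t N, t N.+1[ (fun x => (w N)%:E * (EFin \o g) x)%E.
    by apply: integrableZl => //; exact: measurable_itv.
  apply: eq_integrable; first exact: measurable_itv.
  by move=> x /set_mem/=; rewrite in_itv/= => xN; rewrite /= -EFinM -phiE.
have phiN : \int[mu]_(x in `[t N, t N.+1[) phi x =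
    w N * \int[mu]_(x in `[t N, t N.+1[) g x.
  rewrite -RintegralZl//; apply: eq_Rintegral => x /set_mem/=; rewrite in_itv/=.
  exact: phiE.
have splitE : `[t 0%N, t N.+1[%classic = (`[t 0%N, t N[ `|` `[t N, t N.+1[)%classic.
  by apply: itv_bndbnd_setU; rewrite bnd_simp// tmono.
have disj : [disjoint `[t 0%N, t N[%classic & `[t N, t N.+1[%classic].
  apply/disj_setPS => y [/=]; rewrite 2!in_itv/= => /andP[_ yx] /andP[].
  by rewrite leNgt yx.
have iU : mu.-integrable `[t 0%N, t N.+1[ (EFin \o phi).
  have /integrableP[m1 i1] := ip; have /integrableP[m2 i2] := iN.
  have mU : measurable_fun (`[t 0%N, t N[ `|` `[t N, t N.+1[)%classic (EFin \o phi).
    by apply/measurable_funU => //; exact: measurable_itv.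
  rewrite splitE; apply/integrableP; split; first exact: mU.
  rewrite ge0_integral_setU//; first exact: lte_add_pinfty.
  exact: measurableT_comp.
by split => //; rewrite big_nat_recr//= -pE -phiN splitE Rintegral_setU// -splitE.
Qed.
End StepIntegral.

Section WalshCells.
Variables (R : realType) (b : nat).
Hypothesis b1 : (1 < b)%N.
Local Notation mu := (@lebesgue_measure R).
Local Notation eta := (conj_omega R b).
Local Notation W := (dwalsh b eta).

Definition node n j : R := j%:R / (b ^ n)%:R.

Let bX0 n : (0 : R) < (b ^ n)%:R. Proof. by rewrite ltr0n expn_gt0 ltnW. Qed.

Lemma node0 n : node n 0 = 0. Proof. by rewrite /node mul0r. Qed.

Lemma node_end n : node n (b ^ n) = 1. Proof. by rewrite /node divff// gt_eqF. Qed.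

Lemma node_le n i j : (i <= j)%N -> node n i <= node n j.
Proof. by move=> ij; rewrite /node ler_pM2r ?invr_gt0// ler_nat. Qed.

Lemma node_ge0 n j : 0 <= node n j.
Proof. by rewrite -(node0 n) node_le. Qed.

Lemma node_le1 n j : (j <= b ^ n)%N -> node n j <= 1.
Proof. by move=> jn; rewrite -(node_end n) node_le. Qed.

Lemma node_step n j : node n j.+1 - node n j = (b ^ n)%:R^-1.
Proof. by rewrite /node -mulrBl -natrB// subSnn mul1r. Qed.

(** On the cell, truncating b^p x gives j divided by b^(n - p), whose last digit is then taken. *)
Lemma rdigit_cell n j p (x : R) : (p <= n)%N -> node n j <= x < node n j.+1 ->
  rdigit b x p = cell_digit b n j p.
Proof.
move=> pn; rewrite /node ler_pdivrMr// ltr_pdivlMr// => /andP[lo hi].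
congr (_ %% _)%N; apply: truncn_def.
set e := (n - p)%N; have be0 := bX0 e.
have nE : (b ^ n)%:R = b%:R ^+ p * (b ^ e)%:R :> R.
  by rewrite -natrX -natrM -expnD subnKC.
rewrite nE mulrA [x * _]mulrC in lo; rewrite nE mulrA [x * _]mulrC in hi.
have be : (0 < b ^ e)%N by rewrite -(ltr0n R).
rewrite -(ler_pM2r be0) -(ltr_pM2r be0) -!natrM; apply/andP; split.
  by apply: le_trans lo; rewrite ler_nat leq_divM.
by apply: lt_le_trans hi _; rewrite ler_nat ltn_ceil.
Qed.

Lemma conj_wal_cell n k j (x : R) : (k < b ^ n)%N ->
  node n j <= x < node n j.+1 -> conjc (wal b k x) = W n k j.
Proof.
move=> kn xj; rewrite /wal rmorphXn /=; congr (_ ^+ _).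
apply: (eq_walsh_exp b1 kn) => p /andP[_ pn]; exact: rdigit_cell.
Qed.

Lemma cell_integrable (f : R -> R) (x y : R) : mu.-integrable `[0, 1] (EFin \o f) ->
  0 <= x -> y <= 1 -> mu.-integrable `[x, y] (EFin \o f).
Proof.
move=> jf x0 y1; apply: integrableS jf => //.
by apply: subset_itv; rewrite bnd_simp.
Qed.

Lemma cell_integrable_co (f : R -> R) (x y : R) : mu.-integrable `[0, 1] (EFin \o f) ->
  0 <= x -> y <= 1 -> mu.-integrable `[x, y[ (EFin \o f).
Proof.
move=> jf x0 y1; apply: integrableS jf => //.
by apply: subset_itv; rewrite bnd_simp.
Qed.

Lemma Rintegral_cells n (f : R -> R) : mu.-integrable `[0, 1] (EFin \o f) ->
  \int[mu]_(x in `[0, 1]) f x =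
  \sum_(0 <= j < b ^ n) \int[mu]_(x in `[node n j, node n j.+1[) f x.
Proof.
move=> jf; rewrite -Rintegral_itv_bndo_bndc; last exact: cell_integrable_co.
have [j|j x _ _||_ fE] := @step_Rintegral R f f (fun=> 1) (node n) (b ^ n).
- exact: node_le.
- by rewrite mul1r.
- by rewrite node0 node_end; exact: cell_integrable_co.
by move: fE; rewrite node0 node_end => ->; apply: eq_bigr => j _; rewrite mul1r.
Qed.

Lemma walsh_coeff_sum n k (g : R -> R) : (k < b ^ n)%N ->
  mu.-integrable `[0, 1] (EFin \o g) ->
  walsh_coeff b g k = \sum_(0 <= j < b ^ n)
    W n k j * (\int[mu]_(x in `[node n j, node n j.+1[) g x)%:C%C.
Proof.
move=> kn ig.
have ig' : mu.-integrable `[node n 0, node n (b ^ n)[ (EFin \o g).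
  by rewrite node0 node_end; exact: cell_integrable_co.
(* [P] stands for the real or the imaginary part; both commute with real factors. *)
have part (P : R[i] -> R) : (forall (u : R) z, P (u%:C%C * z) = P z * u) ->
    \int[mu]_(x in `[0, 1]) P ((g x)%:C%C * conjc (wal b k x)) =
    \sum_(0 <= j < b ^ n) P (W n k j) *
      \int[mu]_(x in `[node n j, node n j.+1[) g x.
  move=> PM.
  have [j|j x jn xj||] := @step_Rintegral R
    (fun x => P ((g x)%:C%C * conjc (wal b k x))) g
    (fun j => P (W n k j)) (node n) (b ^ n).
  - exact: node_le.
  - by rewrite PM (conj_wal_cell kn xj).
  - exact: ig'.
  - by rewrite node0 node_end => i1 <-; rewrite Rintegral_itv_bndo_bndc.
rewrite /walsh_coeff /cintegral (part (@complex.Re R)); last first.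
  by move=> u [z1 z2] /=; ring.
rewrite (part (@complex.Im R)); last first.
  by move=> u [z1 z2] /=; ring.
elim: (b ^ n)%N => [|N IH]; first by rewrite !big_geq.
rewrite !big_nat_recr//= -IH.
case: (W n k N) => w1 w2 /=; apply/eqP; rewrite eq_complex /=.
by apply/andP; split; apply/eqP; ring.
Qed.
End WalshCells.

Section WalshStep.
Variables (R : realType) (b : nat).
Hypothesis b1 : (1 < b)%N.
Local Notation mu := (@lebesgue_measure R).
Local Notation eta := (conj_omega R b).
Local Notation S := (sin_factor R b).
Local Notation W := (dwalsh b eta).
Let bR0 : (0 : R) < b%:R. Proof. by rewrite ltr0n ltnW. Qed.

Lemma le_of_inv_expn_bound (a : nat) (x y C : R) :
  (forall n, (a <= n)%N -> x <= y + b%:R ^- n * C) -> x <= y.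
Proof.
move=> H; apply/ler_addgt0Pr => e e0.
pose n := maxn a (Num.truncn (`|C| / e)).+1.
apply: le_trans (H n (leq_maxl _ _)) _; rewrite lerD2l.
apply: (@le_trans _ _ (b%:R ^- n * `|C|)).
  by rewrite ler_wpM2l ?ler_norm// invr_ge0 exprn_ge0// ltW.
rewrite mulrC ler_pdivrMr ?exprn_gt0// mulrC -ler_pdivrMr//.
apply: (@le_trans _ _ n%:R).
  apply: le_trans (ltW (truncnS_gt _)) _; by rewrite ler_nat leq_maxr.
by rewrite -natrX ler_nat ltnW// ltn_expl.
Qed.

Variables (g h : R -> R).
Hypotheses (ig : mu.-integrable `[0, 1] (EFin \o g))
  (ih : mu.-integrable `[0, 1] (EFin \o h))
  (gh : forall x y, 0 <= x -> x <= y -> y <= 1 ->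
    \int[mu]_(t in `[x, y]) h t = g y - g x).

(** For t in the cell, [g y - g t] is the integral of [h] over [t, y], hence at most the integral of
    [|h|] over the cell; integrating over t gives the factor y - x. *)
Lemma cell_mean_error (x y : R) : 0 <= x -> x <= y -> y <= 1 ->
  `|\int[mu]_(t in `[x, y[) g t - (y - x) * g y| <=
    (y - x) * \int[mu]_(t in `[x, y[) `|h t|.
Proof.
move=> x0 xy y1; have mxy : measurable (`[x, y[%classic : set (measurableTypeR R)).
  exact: measurable_itv.
have igxy := cell_integrable_co ig x0 y1.
have ihxy := cell_integrable_co ih x0 y1.
have fm : fine (mu `[x, y[%classic) = y - x.
  rewrite lebesgue_measure_itv /= lte_fin.
  by move: xy; rewrite le_eqVlt => /predU1P[->|->]//; rewrite ltxx subrr.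
have icst (u : R) : mu.-integrable `[x, y[ (EFin \o cst u).
  apply: cell_integrable_co => //; apply: continuous_compact_integrable.
    exact: segment_compact.
  by apply: continuous_subspaceT => z; exact: cvg_cst.
have -> : (y - x) * g y = \int[mu]_(t in `[x, y[) (cst (g y) t).
  by rewrite Rintegral_cst// fm mulrC.
rewrite -RintegralB//.
apply: le_trans (le_normr_Rintegral _ _) _ => //.
  have -> : EFin \o (fun t => g t - cst (g y) t) =
    ((EFin \o g) \- (EFin \o cst (g y)))%E by [].
  by apply: integrableB => //; exact: icst.
rewrite mulrC -fm -Rintegral_cst//.
apply: le_Rintegral => //.
- apply: integrable_norm => //.
  have -> : EFin \o (fun t => g t - cst (g y) t) =
    ((EFin \o g) \- (EFin \o cst (g y)))%E by [].
  by apply: integrableB => //; exact: icst.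
- exact: icst.
move=> t /=; rewrite in_itv/= => /andP[xt ty].
have t0 := le_trans x0 xt.
rewrite distrC -gh ?(ltW ty)//.
have it : mu.-integrable `[t, y] (EFin \o h) by exact: cell_integrable.
apply: le_trans (le_normr_Rintegral _ it) _ => //.
rewrite -(Rintegral_itv_bndo_bndc (f := fun z => `|h z|)); last first.
  by apply: integrable_norm; apply: cell_integrable_co.
rewrite /Rintegral; apply: fine_le.
- apply: integrable_fin_num => //; apply: integrable_norm.
  exact: cell_integrable_co.
- by apply: integrable_fin_num => //; apply: integrable_norm.
apply: ge0_subset_integral => //.
- have /integrableP[] // : mu.-integrable `[x, y[ (EFin \o (fun z => `|h z|)).
  exact: integrable_norm.
- by apply: subset_itv; rewrite bnd_simp.
Qed.

Variables a kap k' : nat.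
Hypotheses (a0 : (0 < a)%N) (kap0 : (0 < kap)%N)
  (kapb : (kap < b)%N) (k'a : (k' < b ^ a.-1)%N).
Let k := (kap * b ^ a.-1 + k')%N.

(* On the cells of mesh b^-n, g is replaced by its value at the right end point,
   at the cost of b^-n times the L1 norm of h; then n tends to infinity. *)
Lemma normc_walsh_coeff_le (v : nat -> R) (U : R) :
  (forall c t, (0 < c)%N -> (0 < t < b)%N ->
    normc (walsh_coeff b h (walsh_child b a kap k' c t)) <= v c) ->
  (forall m, \sum_(1 <= c < m.+1) b%:R ^- c * v c <= U) ->
  normc (walsh_coeff b g k) <= b%:R ^- a *
    (S * (normc (walsh_coeff b h k') + normc (walsh_coeff b h k) + (b%:R - 1) * U)).
Proof.
move=> vP vU; pose V := \int[mu]_(t in `[0, 1]) `|h t|.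
(* The error constant has two sources: the leftover summand of [normc_sum_dwalsh_le], and [V] for
   the replacement of [g] by its right end values. *)
apply: (@le_of_inv_expn_bound a _ _ (normc (walsh_coeff b h k) / 2 + V)) => n an.
have bn0 : 0 < b%:R ^+ n :> R by rewrite exprn_gt0.
have ka := expn_top a0 kapb k'a; rewrite -/k in ka.
have kn : (k < b ^ n)%N by rewrite (leq_trans ka)// leq_exp2l.
have k'n : (k' < b ^ n)%N.
  by rewrite (leq_trans k'a)// leq_exp2l// (leq_trans (leq_pred _) an).
pose u j : R[i] := (g (node R b n j))%:C%C.
have node01 j : (j < b ^ n)%N -> [/\ 0 <= node R b n j,
    node R b n j <= node R b n j.+1 & node R b n j.+1 <= 1].
  by move=> jn; rewrite node_ge0// node_le1// node_le.
(* Increments of [g] are cell integrals of [h], so these discrete coefficients are exact at every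
   level n. *)
have dE l : (l < b ^ n)%N ->
    dcoeff b eta n (fun j => u j.+1 - u j) l = walsh_coeff b h l.
  move=> ln; rewrite (walsh_coeff_sum b1 ln ih); apply: eq_big_nat => j.
  move=> /andP[_ /node01[j0 j1 j2]].
  rewrite Rintegral_itv_bndo_bndc; last exact: cell_integrable_co.
  by rewrite gh// /u rmorphB.
have childE c t : (0 < c <= n - a)%N -> (0 < t < b)%N ->
    (walsh_child b a kap k' c t < b ^ n)%N.
  move=> /andP[c0 cm] /andP[t0 tb].
  have /leq_trans -> // : (walsh_child b a kap k' c t < b ^ (a + c))%N.
    by apply: expn_top => //; [rewrite addn_gt0 a0|exact: expn_child].
  by rewrite leq_exp2l// -(subnKC an) leq_add2l.
have bound : normc (\sum_(0 <= j < b ^ n) W n k j * u j.+1) <=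
    b%:R ^+ (n - a) * (S * (normc (walsh_coeff b h k') + normc (walsh_coeff b h k) +
      (b%:R - 1) * U)) + normc (walsh_coeff b h k) / 2.
  rewrite -(dE k')// -(dE k)//.
  apply: (normc_sum_dwalsh_le b1 a0 an kap0 kapb k'a (v := v)) => //.
  move=> c t cm tb; rewrite dE ?childE//; apply: vP => //; by case/andP: cm.
pose r j := \int[mu]_(x in `[node R b n j, node R b n j.+1[) g x -
  (node R b n j.+1 - node R b n j) * g (node R b n j.+1).
have gE : walsh_coeff b g k = (b%:R ^- n : R)%:C%C *
    (\sum_(0 <= j < b ^ n) W n k j * u j.+1)
    + \sum_(0 <= j < b ^ n) W n k j * (r j)%:C%C.
  rewrite (walsh_coeff_sum b1 kn ig) mulr_sumr -big_split /=.
  apply: eq_bigr => j _; rewrite mulrCA -mulrDr /u -rmorphM -rmorphD.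
  congr (_ * (_ )%:C%C).
  by rewrite /r node_step natrX addrC subrK.
have rV : normc (\sum_(0 <= j < b ^ n) W n k j * (r j)%:C%C) <= b%:R ^- n * V.
  apply: le_trans (normc_sum _ _ _) _.
  rewrite /V (Rintegral_cells b1 n); last exact: integrable_norm.
  rewrite mulr_sumr big_nat [leRHS]big_nat; apply: ler_sum => j.
  move=> /andP[_ /node01[j0 j1 j2]]; rewrite normcM normc_dwalsh mul1r normc_real.
  apply: le_trans (cell_mean_error j0 j1 j2) _.
  by rewrite node_step// natrX.
rewrite gE [b%:R ^- n * (_ + V)]mulrDr addrA.
apply: le_trans (ler_normcD _ _) _; apply: lerD rV.
rewrite normcM normc_real ger0_norm ?invr_ge0 ?(ltW bn0)//.
apply: le_trans (ler_wpM2l _ bound) _; first by rewrite invr_ge0 ltW.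
set X := S * _; rewrite mulrDr mulrA lerD2r.
have -> : b%:R ^- n * b%:R ^+ (n - a) = b%:R ^- a :> R; last by [].
by rewrite -{1}(subnK an) exprD invfM mulrAC mulVf ?mul1r// expf_neq0// gt_eqF.
Qed.

End WalshStep.

(** * Induction on the smoothness *)

Section CoeffBounds.
Variables (R : realType) (b : nat).
Hypothesis b1 : (1 < b)%N.
Local Notation mu := (@lebesgue_measure R).
Local Notation S := (sin_factor R b).
Let bR0 : (0 : R) < b%:R. Proof. by rewrite ltr0n ltnW. Qed.
Let bR1 : (1 : R) < b%:R. Proof. by rewrite ltr1n. Qed.

Lemma normc_walsh_coeff_le_L1 (h : R -> R) k : mu.-integrable `[0, 1] (EFin \o h) ->
  normc (walsh_coeff b h k) <= \int[mu]_(x in `[0, 1]) `|h x|.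
Proof.
move=> ih; rewrite (walsh_coeff_sum b1 (ltn_expl k b1) ih).
apply: le_trans (normc_sum _ _ _) _.
rewrite (Rintegral_cells b1 k); last exact: integrable_norm.
rewrite big_nat [leRHS]big_nat; apply: ler_sum => j /andP[_ jn].
rewrite normcM normc_dwalsh mul1r normc_real.
apply: le_normr_Rintegral => //.
by apply: cell_integrable_co; rewrite ?node_ge0 ?node_le1.
Qed.

Lemma walsh_coeff0 (h : R -> R) : mu.-integrable `[0, 1] (EFin \o h) ->
  \int[mu]_(x in `[0, 1]) h x = 0 -> walsh_coeff b h 0 = 0.
Proof.
move=> ih h0; rewrite (@walsh_coeff_sum R b b1 0)// expn0 big_nat1.
have := node_end R b1 0; rewrite expn0 node0 => ->.
rewrite Rintegral_itv_bndo_bndc; last exact: cell_integrable_co.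
by rewrite h0 mulr0.
Qed.

Lemma geometric_sum_le (q : R) m : 1 < q ->
  \sum_(1 <= c < m.+1) q ^- c <= (q - 1)^-1.
Proof.
move=> q1; have q0 : 0 < q := lt_trans ltr01 q1.
have q10 : 0 < q - 1 by rewrite subr_gt0.
have -> : \sum_(1 <= c < m.+1) q ^- c = (q - 1)^-1 * (1 - q ^- m).
  elim: m => [|m IH]; first by rewrite big_geq// expr0 invr1 subrr mulr0.
  rewrite big_nat_recr//= IH exprS; field.
  by rewrite !gt_eqF// exprn_gt0.
rewrite ler_piMr ?invr_ge0 ?(ltW q10)// lerBlDr lerDl invr_ge0.
by rewrite exprn_ge0// ltW.
Qed.

(** When k' > 0, the three terms are the contributions of k', of k and of all the [walsh_child]
    indices, in this order. *)
Definition step_factor : R := 1 + 1 / b%:R + 1 / (b%:R * (b%:R + 1)).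

Variables (g h : R -> R).
Hypotheses (ig : mu.-integrable `[0, 1] (EFin \o g))
  (ih : mu.-integrable `[0, 1] (EFin \o h))
  (gh : forall x y, 0 <= x -> x <= y -> y <= 1 ->
    \int[mu]_(t in `[x, y]) h t = g y - g x).

(** The constant 3 counts [V] for k', [V] for k, and [V] for all the children together, as the sum
    of b^-c is at most 1/(b - 1). *)
Lemma walsh_coeff_base k (V := \int[mu]_(x in `[0, 1]) `|h x|) : (0 < k)%N ->
  normc (walsh_coeff b g k) <= 3 * S * V * b%:R ^- mu_per b 1 k.
Proof.
move=> /(leading_digitP b1)[a [kap [k' [a0 kap0 kapb k'a ->]]]].
rewrite mu_perE positions_top// mu_seqS mu_seq0 addn0.
have V0 : 0 <= V by apply: Rintegral_ge0 => x _.
apply: le_trans (normc_walsh_coeff_le b1 ig ih gh a0 kap0 kapb k'a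
  (v := fun=> V) (U := V / (b%:R - 1)) _ _) _.
- by move=> c t _ _; exact: normc_walsh_coeff_le_L1.
- by move=> m; rewrite -mulr_suml mulrC ler_wpM2l// geometric_sum_le.
rewrite mulrC ler_wpM2r ?invr_ge0 ?exprn_ge0// ?(ltW bR0)//.
rewrite [3 * S]mulrC -mulrA ler_wpM2l ?(ltW (sin_factor_gt0 R b1))//.
have -> : 3 * V = V + V + (b%:R - 1) * (V / (b%:R - 1)).
  by field; rewrite gt_eqF// subr_gt0.
by rewrite !lerD// normc_walsh_coeff_le_L1.
Qed.

Hypothesis h0 : \int[mu]_(x in `[0, 1]) h x = 0.

(** The bound on the coefficients of [h] is used at k', k and the children. It says nothing at k' =
    0, where the vanishing integral of [h] takes its place. *)
Lemma walsh_coeff_induction j (K : R) : 0 <= K -> (0 < j)%N ->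
  (forall k, (0 < k)%N -> normc (walsh_coeff b h k) <= K * b%:R ^- mu_per b j k) ->
  forall k, (0 < k)%N ->
    normc (walsh_coeff b g k) <= K * (S * step_factor) * b%:R ^- mu_per b j.+1 k.
Proof.
move=> K0 j0 hK k /(leading_digitP b1)[a [kap [k' [a0 kap0 kapb k'a ->]]]].
have ss : sorted gtn (a :: positions b k').
  rewrite -(positions_top b1 a0 kap0 kapb k'a).
  by have [] := positionsP (kap * b ^ a.-1 + k') b1.
set k0 := (kap * b ^ a.-1 + k')%N.
have k0pos : (0 < k0)%N by rewrite addn_gt0 muln_gt0 kap0 expn_gt0 (ltnW b1).
have pk : positions b k0 = a :: positions b k' by exact: positions_top.
set s := positions b k' in ss pk.
(* When v = 1 the term of index k' vanishes; otherwise the exponents of all the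
   other terms gain one. *)
pose e : nat := ~~ nilp s.
have [M' ME] : exists M', mu_per b j.+1 k0 = (a + M')%N.
  by rewrite mu_perE pk mu_seqS; eexists.
have le2 := @mu_seq_le2 j a s ss.
have [F2a F2b] := le2; rewrite -pk -!mu_perE ME leq_add2l ltn_add2l in F2a F2b.
have F2 : (M' + e <= mu_per b j k0)%N.
  by rewrite /e; case: nilp F2b => /= F2b; [rewrite addn0|rewrite addn1 F2b].
(* A child puts the position a + c in front of those of [k0]: its exponent is a + c + mu_(j-1)(k0),
   which is at least c + mu_j(k0). *)
have F3 c t : (0 < c)%N -> (0 < t < b)%N ->
    (M' + e + c <= mu_per b j (walsh_child b a kap k' c t))%N.
  move=> c0 /andP[t0 tb]; rewrite mu_perE positions_top ?addn_gt0 ?a0//; last first.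
    exact: expn_child.
  rewrite -/k0 pk -(prednK j0) mu_seqS /=.
  have [F4 _] := @mu_seq_le2 j.-1 a s ss; rewrite prednK// in F4.
  move: F2 F4; rewrite mu_perE pk; lia.
have bexp p q : (p <= q)%N -> b%:R ^- q <= b%:R ^- p :> R.
  by move=> pq; rewrite lef_pV2 ?posrE ?exprn_gt0// ler_weXn2l// ltW.
pose E : R := b%:R ^- (M' + e).
have E0 : 0 <= E by rewrite invr_ge0 exprn_ge0// ltW.
have bb : 1 < b%:R ^+ 2 :> R by rewrite exprn_egt1.
(* The decay b^-c of the children meets the weight b^-c, so [U] is a geometric series of ratio b^-2.
   Multiplied by b - 1 it leaves 1/(b + 1). *)
apply: le_trans (normc_walsh_coeff_le b1 ig ih gh a0 kap0 kapb k'a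
  (v := fun c => K * (E * b%:R ^- c)) (U := K * E * (b%:R ^+ 2 - 1)^-1) _ _) _.
- move=> c t c0 tb; apply: le_trans (hK _ _) _.
    by rewrite /walsh_child -/k0 addn_gt0 k0pos orbT.
  by rewrite ler_wpM2l// /E -invfM -exprD bexp// F3.
- move=> m; rewrite (eq_bigr (fun c => K * E * (b%:R ^+ 2) ^- c)); last first.
    by move=> c _; rewrite -exprM mulnC exprM expr2 invfM; ring.
  by rewrite -mulr_sumr ler_wpM2l ?mulr_ge0// geometric_sum_le.
rewrite -/k0 ME exprD invfM.
have -> : K * (S * step_factor) * (b%:R ^- a * b%:R ^- M') =
    b%:R ^- a * (S * (K * step_factor * b%:R ^- M')) :> R by ring.
rewrite ler_wpM2l ?invr_ge0 ?exprn_ge0 ?(ltW bR0)//.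
rewrite ler_wpM2l ?(ltW (sin_factor_gt0 R b1))//.
have h1 : normc (walsh_coeff b h k0) <= K * E.
  by apply: le_trans (hK _ k0pos) _; rewrite ler_wpM2l// bexp.
have third : (b%:R - 1) * (K * E * (b%:R ^+ 2 - 1)^-1) = K * E / (b%:R + 1) :> R.
  have -> : b%:R ^+ 2 - 1 = (b%:R - 1) * (b%:R + 1) :> R by ring.
  by field; rewrite !gt_eqF// ?subr_gt0// addr_gt0.
rewrite third.
have bp : 0 < b%:R + 1 :> R by rewrite addr_gt0.
(* If k has one nonzero digit, what remains is 1 + 1/(b + 1), smaller than [step_factor] by 2/(b(b +
   1)). *)
have [s0|s0] := boolP (nilp s).
  have -> : normc (walsh_coeff b h k') = 0.
    have /eqP -> : k' == 0%N by rewrite -(positions_nil b1) -/s; move: s0; case: (s).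
    by rewrite walsh_coeff0// normc0.
  have EM : E = b%:R ^- M' by rewrite /E /e s0 addn0.
  apply: le_trans (_ : 0 + K * E + K * E / (b%:R + 1) <= _).
    by rewrite lerD2r lerD2l.
  rewrite EM -[X in X <= _]mulr1; rewrite /step_factor.
  have -> : K * (1 + 1 / b%:R + 1 / (b%:R * (b%:R + 1))) * b%:R ^- M' =
     K * b%:R ^- M' * (1 + 1 / (b%:R + 1) + 2 / (b%:R * (b%:R + 1))).
    by field; rewrite !gt_eqF// exprn_gt0.
  have -> : (0 + K * b%:R ^- M' + K * b%:R ^- M' / (b%:R + 1)) * 1 =
     K * b%:R ^- M' * (1 + 1 / (b%:R + 1)) by field; rewrite !gt_eqF// exprn_gt0.
  rewrite ler_wpM2l ?mulr_ge0 ?invr_ge0 ?exprn_ge0 ?(ltW bR0)// lerDl.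
  by rewrite divr_ge0// mulr_ge0// ltW.
have k'0 : (0 < k')%N.
  by rewrite lt0n -(positions_nil b1) -/s; move: s0; case: (s).
have EM : E = b%:R ^- M' / b%:R by rewrite /E /e s0 addn1 exprSr invfM.
have hk' : normc (walsh_coeff b h k') <= K * b%:R ^- M'.
  apply: le_trans (hK _ k'0) _; rewrite ler_wpM2l// bexp// mu_perE -/s.
  move: ME; rewrite mu_perE pk mu_seqS (negbTE s0) => /addnI <-//.
apply: le_trans (_ : K * b%:R ^- M' + K * E + K * E / (b%:R + 1) <= _).
  by rewrite lerD2r lerD.
(* With at least two nonzero digits, the three contributions add up to [step_factor] exactly. *)
rewrite EM /step_factor le_eqVlt; apply/orP; left; apply/eqP.
by field; rewrite !gt_eqF// exprn_gt0.
Qed.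

End CoeffBounds.

(** The crude upper bound 2 suffices: it makes 3 times the factor at most 6, below the 2 * (7/2)
    available in the theorem. *)
Lemma step_factor_bounds (R : realType) (b : nat) : (1 < b)%N ->
  0 < step_factor R b <= 2.
Proof.
move=> b1; have b2 : (2 : R) <= b%:R by rewrite ler_nat.
have b0 : (0 : R) < b%:R by lra.
have bi : b%:R^-1 <= 2^-1 :> R by rewrite lef_pV2 ?posrE.
have bi0 : 0 < b%:R^-1 :> R by rewrite invr_gt0.
have ci : (b%:R * (b%:R + 1))^-1 <= b%:R^-1 :> R.
  by rewrite lef_pV2 ?posrE ?mulr_gt0 ?addr_gt0// ler_peMr// ?lerDr ltW.
have ci0 : 0 < (b%:R * (b%:R + 1))^-1 :> R by rewrite invr_gt0 mulr_gt0 ?addr_gt0.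
rewrite /step_factor !div1r; apply/andP; split; lra.
Qed.

Theorem theorem4 (R : realType) (b r k : nat) (f : R -> R)
  (hb : (2 <= b)%N) (hr : (1 < r)%N) (hk : (0 < k)%N)
  (hf : sobolev_per r f) :
  normc (walsh_coeff b f k) <=
    (\int[lebesgue_measure]_(x in `[0, 1]) `|derive_in_n `[0, 1] r f x|)
    * (2 * b%:R ^- mu_per b r k / (2 * sin (pi / b%:R)) ^+ r)
    * (1 + 1 / b%:R + 1 / (b%:R * (b%:R + 1))) ^+ (r - 2)
    * (7 / 2 + 2 / b%:R + (2 * b%:R + 1) / (b%:R - 1)).
Proof.
set V := \int[_]_(x in _) _.
have V0 : 0 <= V by apply: Rintegral_ge0 => x _.
have [hs hper] := hf; have [hac _ _] := hs.
have S0 := sin_factor_gt0 R hb; have /andP[F0 F2] := step_factor_bounds R hb.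
(* Descent from the derivative of order r - 1, at j = 0, to [f] itself, at j = r - 1; each step
   raises the order of the exponent by one. *)
have bound j : (j < r)%N -> forall l, (0 < l)%N ->
    normc (walsh_coeff b (derive_in_n `[0, 1] (r - j.+1) f) l) <=
    3 * sin_factor R b * V * (sin_factor R b * step_factor R b) ^+ j
    * b%:R ^- mu_per b j.+1 l.
  elim: j => [|j IH] jr l l0.
    have r1 : (r - 1 < r)%N by rewrite subn1 ltn_predL ltnW.
    have [ih gh] := sobolev_ftc hs r1.
    rewrite expr0 mulr1 /V -{2}(subnK (ltnW hr)) addn1.
    by apply: (walsh_coeff_base hb (ac_integrable (hac _ r1)) ih gh).
  have r2 : (r - j.+2 < r)%N by rewrite -subn_gt0; lia.
  have r1 : (r - j.+1 < r)%N by lia.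
  have [_ gh] := sobolev_ftc hs r2.
  have rE : (r - j.+2).+1 = (r - j.+1)%N by lia.
  rewrite rE in gh.
  have := walsh_coeff_induction hb (ac_integrable (hac _ r2))
    (ac_integrable (hac _ r1)) gh (hper _ r1) _ _ (IH (ltnW jr)) l0.
  rewrite exprSr [3 * _ * _ * (_ * _)]mulrA; apply => //.
  by rewrite !mulr_ge0// ?exprn_ge0// ?mulr_ge0// ltW.
have rr : (r.-1 < r)%N by rewrite ltn_predL ltnW.
have := bound _ rr _ hk; rewrite prednK ?(ltnW hr)// subnn => /le_trans; apply.
have rS : r.-1 = (r - 2).+1 by lia.
rewrite -/(step_factor R b) rS exprMn [step_factor R b ^+ _]exprS.
set F := step_factor R b in F0 F2 *; set s := sin_factor R b in S0 *.
have sE : (2 * sin (pi / b%:R)) ^- r = s * s ^+ (r - 2).+1 :> R.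
  rewrite -exprS /s /sin_factor exprVn; congr ((_ ^+ _)^-1); lia.
rewrite sE.
set B := b%:R ^- mu_per b r k; set X := s ^+ _; set Y := F ^+ (r - 2).
have B0 : 0 <= B by rewrite invr_ge0 exprn_ge0.
(* The r - 1 induction steps give one factor [F] more than the power r - 2 in the statement.
   Together with the 3 of the base case it is absorbed by the last parenthesis. *)
have -> : 3 * s * V * (X * (F * Y)) * B = V * (B * (s * X)) * Y * (3 * F) by ring.
have -> : V * (2 * B * (s * X)) * Y *
    (7 / 2 + 2 / b%:R + (2 * b%:R + 1) / (b%:R - 1)) =
  V * (B * (s * X)) * Y *
    (2 * (7 / 2 + 2 / b%:R + (2 * b%:R + 1) / (b%:R - 1))) by ring.
apply: ler_wpM2l.
  by rewrite !mulr_ge0// ?exprn_ge0// ltW.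
have b1 : (1 : R) < b%:R by rewrite ltr1n.
have q1 : 0 <= 2 / b%:R :> R by rewrite divr_ge0.
have q2 : 0 <= (2 * b%:R + 1) / (b%:R - 1) :> R.
  by apply: divr_ge0; lra.
lra.
Qed.
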